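(* Let $G\in\mathcal{C}$, let $H$ be a hole of $G$ of length greater than six, and let $w$ be a major vertex for $H$ such that either $w$ is not a hub for $H$ or every major vertex for $H$ is a hub for $H$. Let $P=p_1\text{-}\cdots\text{-}p_k$ be an $(H,w)$-significant path. Then $w$ has a neighbor in $P$.
   Context: All graphs are finite and simple; paths are induced paths; a hole is an induced cycle of length at least four. $\mathcal{C}$ is the class of graphs containing no theta, pyramid, prism or turtle as an induced subgraph, where: a theta consists of two nonadjacent vertices $a,b$ and three paths from $a$ to $b$, otherwise vertex-disjoint, any two of which induce a hole; a pyramid consists of a vertex $a$, a triangle $\{b_1,b_2,b_3\}$ and paths $P_i$ from $a$ to $b_i$, pairwise disjoint except at $a$, any two of which induce a hole; a prism consists of two disjoint triangles $\{a_1,a_2,a_3\},\{b_1,b_2,b_3\}$ and pairwise disjoint paths $P_i$ from $a_i$ to $b_i$, any two of which induce a hole; a turtle consists of disjoint paths $P_1$ (from $a_1$ to $b_1$), $P_2$ (from $a_2$ to $b_2$) with $a_1a_2,b_1b_2$ edges and $V(P_1)\cup V(P_2)$ inducing a hole, plus adjacent vertices $x,y$ where $x$ has at least three neighbors in $P_1$ and none in $P_2$, and $y$ has at least three neighbors in $P_2$ and none in $P_1$. For a hole $H$ and a vertex $u$, $N_H(u)$ is the set of neighbors of $u$ in $V(H)\setminus\{u\}$. A vertex $u\notin V(H)$ is minor for $H$ if $N_H(u)\neq\emptyset$ and $N_H(u)$ is contained in the vertex set of some three-vertex subpath of $H$; it is major for $H$ if $N_H(u)\ne\emptyset$ and $u$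 is not minor. A major vertex $u$ is a hub for $H$ if $N_H(u)=\{x,y,z,w'\}$ where $x,y,z,w'$ appear in this order along $H$, $xy,zw'\in E(G)$ and $xw',yz\notin E(G)$. A $w$-sector is a subpath $Q=x\text{-}\cdots\text{-}y$ of $H$ with $x,y$ neighbors of $w$ and no interior vertex adjacent to $w$. An extended neighborhood of $w$ in $H$ is a path of the form $Q\cup(\{x',y'\}\cap N_H(w))$, where $Q=x\text{-}\cdots\text{-}y$ is a $w$-sector and $x',y'$ are the neighbors of $x,y$ respectively in $H\setminus V(Q)$. Two vertices $a,b\in V(H)$ are distant in $H$ with respect to $w$ if no extended neighborhood of $w$ in $H$ contains both $a$ and $b$. A path $P=p_1\text{-}\cdots\text{-}p_k$ of $G$ is $(H,w)$-significant if there exist $a,b\in V(H)$ with $a\in N_H(p_1)\setminus N_H(w)$, $b\in N_H(p_k)$, and $a,b$ distant in $H$ with respect to $w$. *)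

(* Defs.v *)
(* finite simple graphs as symmetric irreflexive relations on a finType. *)
From mathcomp Require Import all_boot.
Set Implicit Arguments. Unset Strict Implicit. Unset Printing Implicit Defensive.

Section Graphs.
Variables (T : finType) (e : rel T).

Definition induced_path (p : seq T) : Prop :=
  0 < size p /\ uniq p /\
  forall (x0 : T) (i j : nat), i < size p -> j < size p ->
    e (nth x0 p i) (nth x0 p j) = (i.+1 == j) || (j.+1 == i).

Definition path_from (p : seq T) (a b : T) : Prop :=
  induced_path p /\ ohead p = Some a /\ last a p = b.

Definition vset (p : seq T) : {set T} := [set v in p].

Definition hole (s : seq T) : Prop :=
  4 <= size s /\ uniq s /\
  {in s &, forall x y, e x y = (y == next s x) || (x == next s y)}.

Definition induces_hole (S : {set T}) : Prop :=
  exists s, hole s /\ vset s = S.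

Definition theta : Prop :=
  exists (a b : T) (P1 P2 P3 : seq T),
    [/\ a != b, ~~ e a b, path_from P1 a b, path_from P2 a b & path_from P3 a b] /\
    [/\ vset P1 :&: vset P2 = [set a; b], vset P1 :&: vset P3 = [set a; b]
      & vset P2 :&: vset P3 = [set a; b]] /\
    [/\ induces_hole (vset P1 :|: vset P2), induces_hole (vset P1 :|: vset P3)
      & induces_hole (vset P2 :|: vset P3)].

Definition pyramid : Prop :=
  exists (a b1 b2 b3 : T) (P1 P2 P3 : seq T),
    [/\ e b1 b2, e b1 b3 & e b2 b3] /\
    [/\ path_from P1 a b1, path_from P2 a b2 & path_from P3 a b3] /\
    [/\ vset P1 :&: vset P2 = [set a], vset P1 :&: vset P3 = [set a]
      & vset P2 :&: vset P3 = [set a]] /\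
    [/\ induces_hole (vset P1 :|: vset P2), induces_hole (vset P1 :|: vset P3)
      & induces_hole (vset P2 :|: vset P3)].

Definition prism : Prop :=
  exists (a1 a2 a3 b1 b2 b3 : T) (P1 P2 P3 : seq T),
    [/\ e a1 a2, e a1 a3 & e a2 a3] /\ [/\ e b1 b2, e b1 b3 & e b2 b3] /\
    [set a1; a2; a3] :&: [set b1; b2; b3] = set0 /\
    [/\ path_from P1 a1 b1, path_from P2 a2 b2 & path_from P3 a3 b3] /\
    [/\ vset P1 :&: vset P2 = set0, vset P1 :&: vset P3 = set0
      & vset P2 :&: vset P3 = set0] /\
    [/\ induces_hole (vset P1 :|: vset P2), induces_hole (vset P1 :|: vset P3)
      & induces_hole (vset P2 :|: vset P3)].

Definition turtle : Prop :=
  exists (a1 b1 a2 b2 x y : T) (P1 P2 : seq T),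
    [/\ path_from P1 a1 b1, path_from P2 a2 b2 & vset P1 :&: vset P2 = set0] /\
    [/\ e a1 a2, e b1 b2 & induces_hole (vset P1 :|: vset P2)] /\
    e x y /\
    [/\ 3 <= #|[set v in P1 | e x v]|, [set v in P2 | e x v] = set0,
        3 <= #|[set v in P2 | e y v]| & [set v in P1 | e y v] = set0].

Definition in_C : Prop := ~ theta /\ ~ pyramid /\ ~ prism /\ ~ turtle.

Definition NH (s : seq T) (u : T) : {set T} := [set v in s | (v != u) && e u v].

(* u is minor for H: N_H(u) nonempty and inside some three-vertex subpath of H
   (the three-vertex subpaths of the hole s are the take 3 (rot i s)). *)
Definition minor (s : seq T) (u : T) : Prop :=
  u \notin s /\ NH s u != set0 /\
  exists i, i < size s /\ NH s u \subset vset (take 3 (rot i s)).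

Definition major (s : seq T) (u : T) : Prop :=
  u \notin s /\ NH s u != set0 /\ ~ minor s u.

Definition cyc_order4 (s : seq T) (a b c d : T) : Prop :=
  [/\ a \in s, b \in s, c \in s & d \in s] /\
  exists i, let r := rot i s in
    index a r < index b r /\ index b r < index c r /\ index c r < index d r.

Definition hub (s : seq T) (u : T) : Prop :=
  major s u /\
  exists x y z w', NH s u = [set x; y; z; w'] /\ cyc_order4 s x y z w' /\
    [/\ e x y, e z w', ~~ e x w' & ~~ e y z].

(* The subpaths of the hole s with at least two vertices are take m (rot i s),
   i < size s, 2 <= m < size s.  (i, m) describes a w-sector if its ends are
   neighbours of w and no interior vertex is. *)
Definition sector (s : seq T) (w : T) (i m : nat) : Prop :=
  i < size s /\ 2 <= m < size s /\
  let Q := take m (rot i s) in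
  forall x0 : T,
    [/\ e w (nth x0 Q 0), e w (nth x0 Q m.-1) &
        forall j, 0 < j < m.-1 -> ~~ e w (nth x0 Q j)].

(* Extended neighbourhood of the sector (i, m): Q together with those of
   x' (= last of rot i s, the vertex before x) and y' (= the vertex after y)
   that are neighbours of w. *)
Definition ext_nbhd (s : seq T) (w : T) (i m : nat) : {set T} :=
  let r := rot i s in
  vset (take m r) :|:
  [set v in take 1 (drop m r) ++ drop (size r).-1 r | e w v].

Definition distant (s : seq T) (w a b : T) : Prop :=
  forall i m, sector s w i m -> ~ (a \in ext_nbhd s w i m /\ b \in ext_nbhd s w i m).

Definition significant (s : seq T) (w : T) (P : seq T) : Prop :=
  induced_path P /\
  exists p1, ohead P = Some p1 /\
  exists a b, [/\ a \in NH s p1 :\: NH s w, b \in NH s (last p1 P) & distant s w a b].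

End Graphs.

(* Main.v *)
(** Write the hole [H] as [x I y y' J x'], where [x I y] is the sector of [w]
    whose interior [I] contains a neighbour of the first vertex of [P], and take
    a shortest offending [P]. Minimality leaves [P] few attachments to [H]: only
    its first vertex meets [I], and only its last one meets [y' J x'] outside
    the neighbours of [w].

    - If a later vertex of [P] touches [x], or if [P] ends at a nonneighbour
      [x'] of [w], then rerouting [H] around [x] through [P] gives a hole on
      which the adjacent vertices [x] and [w] have neighbours in disjoint arcs.
      Two adjacent vertices can only do that trivially: with at least three
      neighbours each they form a turtle, otherwise there is a theta, a pyramid
      or a prism.
    - If [P] touches neither [x] nor [y] after its first vertex, and its end can
      reach [w] through [J], then [P] and that route attach to the small hole
      [w x I y] so as to form a theta or a pyramid.
    - Otherwise [w] is a hub with neighbours [x', x, y, y'], and [P] joins the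
      two long sectors; a prism or a pyramid appears unless [P] is one vertex
      adjacent to [x] and [y], which would be a major vertex that is no hub.

    Length seven is used once: in the cube, [w], its antipode and the hexagon
    between them form a configuration with no forbidden subgraph. *)
Require Import Defs.
From mathcomp Require Import all_boot.
From mathcomp Require Import zify.

Set Implicit Arguments. Unset Strict Implicit. Unset Printing Implicit Defensive.

(** * Induced paths and holes as sequences *)

(** Most contradictions come from two patterns: a connected set off a hole that meets it in one
    vertex, or at both ends of an edge, and elsewhere only through a single vertex [q]. The extreme
    neighbours of [q] coincide, are adjacent or lie apart, and each case is a forbidden subgraph.

    Rerouting works because [x] leaves the hole: what it still sees lies on [P] or at an end of the
    detour, where [w] sees none of it. Every neighbour of [x] on the new hole must then be adjacent
    to every neighbour of [w], and each use exhibits a pair that is not.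

    A significant path may run along [H]; nothing in its definition keeps the two apart.
    Disjointness is itself a consequence of minimality, since a vertex of [P] on [H] hands a
    neighbour on [P] an attachment that shortens the path.

    The vertices [y'] and [x'] lie in the extended neighbourhood of the sector exactly when [w] sees
    them. An attachment there counts as distant only otherwise, unlike one in [J].

    In the cube, [I] and [J] are single vertices and [P] is the antipode of [w]. *)

Section Cycles.
Variables (T : finType) (e : rel T).
Hypotheses (e_sym : symmetric e) (e_irr : irreflexive e).
Implicit Types (p q A B C K L : seq T) (u v x y : T).

(** Recursion on the first vertex replaces the positions of [induced_path], so that paths can be cut
    and joined by [cat] without index arithmetic. The empty sequence is allowed, which keeps the
    splitting lemmas free of side conditions. *)
Fixpoint ipath p : bool :=
  if p is x :: q then
    [&& x \notin q, all (fun v => e x v == (v == head v q)) q & ipath q]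
  else true.

(* The defaults of [last] and [head] are dummies: [p] and [q] are nonempty here. *)
Definition linked p q := forall u v, u \in p -> v \in q ->
  (u != v) /\ e u v = (u == last u p) && (v == head v q).

Definition cyclically_linked p q := forall u v, u \in p -> v \in q ->
  (u != v) /\ e u v = (u == last u p) && (v == head v q)
                   || (u == head u p) && (v == last v q).

Definition ihole K : Prop :=
  if K is x :: L then
    [/\ 3 <= size L, x \notin L, ipath L &
        {in L, forall v, e x v = (v == head v L) || (v == last v L)}]
  else False.

Lemma ipath_cons x p : ipath (x :: p) <->
  [/\ x \notin p, {in p, forall v, e x v = (v == head v p)} & ipath p].
Proof.
split=> /=.
  by case/and3P=> h /allP h2 h3; split=> // v /h2/eqP.
by case=> -> h ->; rewrite andbT; apply/allP=> v /h ->.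
Qed.

Lemma ipath_cat p q : ipath (p ++ q) <-> [/\ ipath p, ipath q & linked p q].
Proof.
elim: p => [|x p IH]; first by split=> [h|[]].
rewrite cat_cons.
split=> [/ipath_cons[]|[/ipath_cons[xp ex hp] hq l]].
  rewrite mem_cat negb_or => /andP[xp xq] ex /IH [hp hq l].
  split=> //.
    apply/ipath_cons; split=> // v vp; rewrite ex ?mem_cat ?vp //.
    by case: (p) vp.
  move=> u v; rewrite inE => /predU1P[->|up] vq; last first.
    have [-> ->] := l u v up vq; split=> //=.
    by case: (p) up.
  split; first by apply: contraNneq xq => ->.
  rewrite ex ?mem_cat ?vq ?orbT //=.
  case: (p) xp l => [|z p'] /= xp l; first by rewrite eqxx.
  have [h _] := l z v (mem_head _ _) vq.
  rewrite eq_sym (negbTE h); apply/esym/andP => -[/eqP xl _].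
  by move: xp; rewrite {1}xl mem_last.
apply/ipath_cons; split.
- rewrite mem_cat (negbTE xp); apply/negP=> xq.
  by have [/eqP] := l x x (mem_head _ _) xq.
- move=> v; rewrite mem_cat => /orP[vp|vq].
    by rewrite ex //; case: (p) vp.
  have [h ->] := l x v (mem_head _ _) vq.
  case: (p) xp l {ex hp IH} => [|z p'] /= xp l; first by rewrite eqxx.
  have zin : z \in [:: x, z & p'] by rewrite !inE eqxx orbT.
  have [h2 _] := l z v zin vq.
  rewrite [RHS]eq_sym (negbTE h2); apply/andP => -[/eqP xl _].
  by move: xp; rewrite {1}xl mem_last.
- apply/IH; split=> // u v up vq.
  have uin : u \in x :: p by rewrite inE up orbT.
  have [-> ->] := l u v uin vq; split=> //=.
  by case: (p) up.
Qed.

Lemma ipath_uniq p : ipath p -> uniq p.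
Proof. by elim: p => // x p IH /ipath_cons[/= -> _ /IH]. Qed.

Lemma linked_rev p q : linked p q -> linked (rev q) (rev p).
Proof.
move=> l u v; rewrite !mem_rev => uq vp.
have [h1 h2] := l v u vp uq; rewrite eq_sym e_sym; split=> //.
rewrite h2 andbC; case/lastP: p vp l {h1 h2} => // p z _ _.
case: q uq => // a q _; by rewrite rev_rcons rev_cons /= !last_rcons.
Qed.

Lemma ipath_rev p : ipath p -> ipath (rev p).
Proof.
elim: p => // x p IH; rewrite -cat1s => /ipath_cat[_ /IH h l].
by rewrite rev_cat; apply/ipath_cat; split=> //; apply: linked_rev.
Qed.

(** Cutting a hole into two arcs gives a description symmetric in the arcs: two induced paths joined
    by exactly the two edges between their ends. Rotating the hole becomes a swap of [p] and [q]. *)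
Lemma ihole_cat p q : p != [::] -> q != [::] ->
  ihole (p ++ q) <-> [/\ 4 <= size p + size q, ipath p, ipath q & cyclically_linked p q].
Proof.
case: p => // x p _ q0; rewrite cat_cons /=.
have laq v : last v q \in q by case: (q) q0 => // a b _; rewrite /= mem_last.
split.
  rewrite size_cat mem_cat negb_or => -[sz /andP[xp xq] /ipath_cat[hp hq l] ex].
  have hqp v : v \in p -> v != last v (p ++ q).
    by move=> vp; rewrite last_cat; have [] := l v _ vp (laq (last v p)).
  split=> //.
  - apply/and3P; split=> //; apply/allP=> v vp.
    rewrite ex ?mem_cat ?vp // (negbTE (hqp v vp)) orbF.
    by case: (p) vp.
  - move=> u v; rewrite inE => /predU1P[->|up] vq.
      split; first by apply: contraNneq xq => ->.
      rewrite ex ?mem_cat ?vq ?orbT //= eqxx /=.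
      have -> : last v (p ++ q) = last v q.
        by rewrite last_cat; case: (q) vq.
      congr (_ || _).
      case: (p) xp l {hqp} => [|z p'] /= xp l; first by rewrite eqxx.
      have [h _] := l z v (mem_head _ _) vq.
      rewrite eq_sym (negbTE h); apply/esym/andP => -[/eqP xl _].
      by move: xp; rewrite {1}xl mem_last.
    have [-> ->] := l u v up vq; split=> //=.
    have -> : u == x = false by apply/eqP => eu; rewrite -eu up in xp.
    by rewrite orbF; case: (p) up.
case=> sz /ipath_cons[xp ex hp] hq l; split.
- by rewrite size_cat; lia.
- rewrite mem_cat (negbTE xp); apply/negP => xq.
  by have [/eqP] := l x x (mem_head _ _) xq.
- apply/ipath_cat; split=> // u v up vq.
  have uin : u \in x :: p by rewrite inE up orbT.
  have [-> ->] := l u v uin vq; split=> //=.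
  have -> : u == x = false by apply/eqP => eu; rewrite -eu up in xp.
  by rewrite orbF; case: (p) up.
- move=> v; rewrite mem_cat => /orP[vp|vq].
    rewrite ex //.
    have vin : v \in x :: p by rewrite inE vp orbT.
    have [/negbTE h _] := l v _ vin (laq (last v p)).
    by rewrite last_cat h orbF; case: (p) vp.
  have [h ->] := l x v (mem_head _ _) vq; rewrite /= eqxx /=.
  have -> : last v (p ++ q) = last v q.
    by rewrite last_cat; case: (q) vq.
  congr (_ || _).
  case: (p) xp l {ex hp sz} => [|z p'] /= xp l; first by rewrite eqxx.
  have zin : z \in [:: x, z & p'] by rewrite !inE eqxx orbT.
  have [h2 _] := l z v zin vq.
  rewrite [RHS]eq_sym (negbTE h2); apply/andP => -[/eqP xl _].
  by move: xp; rewrite {1}xl mem_last.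
Qed.

Lemma cyclically_linkedC p q : cyclically_linked p q -> cyclically_linked q p.
Proof.
move=> l u v uq vp; have [h1 h2] := l v u vp uq.
by rewrite eq_sym e_sym h2 orbC andbC [X in _ || X]andbC.
Qed.

Lemma ihole_catC p q : ihole (p ++ q) -> ihole (q ++ p).
Proof.
case: p => [|x p]; first by rewrite cats0.
case: q => [|y q]; first by rewrite cats0.
case/ihole_cat=> // s hp hq l; apply/ihole_cat=> //.
by split=> //; [rewrite addnC | apply: cyclically_linkedC].
Qed.

Lemma ihole_rev K : ihole K -> ihole (rev K).
Proof.
case: K => // x L; rewrite -cat1s => hK.
have L0 : L != [::] by case: L hK => // -[].
have [s _ hL l] : [/\ 4 <= size [:: x] + size L, ipath [:: x],
    ipath L & cyclically_linked [:: x] L].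
  by apply/ihole_cat.
rewrite rev_cat; apply/ihole_cat=> //; first by rewrite -size_eq0 size_rev size_eq0.
split=> //; first by rewrite size_rev addnC.
  exact: ipath_rev.
move=> u v; rewrite mem_rev inE => uL /eqP->.
have [h1 h2] := l x u (mem_head _ _) uL.
rewrite eq_sym h1 e_sym h2 /= eqxx !andbT; split=> //.
case/lastP: (L) uL => // q z _; case: q => [//|a q].
by rewrite rev_rcons rev_cons /= !last_rcons orbC.
Qed.

Lemma ihole_infix A B C : A ++ C != [::] -> ihole (A ++ B ++ C) -> ipath B.
Proof.
case: B => // b B h0; rewrite catA => /ihole_catC; rewrite catA => /ihole_catC.
by case/ihole_cat=> //; case: A h0 => //; case: C.
Qed.

Lemma ihole_mem x K : ihole K -> x \in K ->
  exists2 L, ihole (x :: L) & (x :: L) =i K.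
Proof.
move=> hK xK; case/splitPr: xK hK => A B /ihole_catC h.
by exists (B ++ A) => // v; rewrite -cat_cons !mem_cat orbC.
Qed.

(** Adjacent vertices are consecutive on a hole, so it can be cut open between them. Reversal
    handles the case where [y] comes right after [x]. *)
Lemma ihole_edge x y K : ihole K -> x \in K -> y \in K -> e x y ->
  exists2 L, ihole (x :: rcons L y) & (x :: rcons L y) =i K.
Proof.
move=> hK xK yK exy; have [L hL iL] := ihole_mem hK xK.
have yL : y \in L.
  by move: yK; rewrite -iL inE => /predU1P[h|//]; rewrite h e_irr in exy.
have [_ _ _ ex] := hL; have := ex y yL; rewrite exy => /esym/orP[].
  case: L yL hL iL {ex} => // a L _ hL iL /= /eqP ya; rewrite -{}ya in hL iL.
  have := @ihole_rev _ (@ihole_catC [:: x] _ hL).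
  rewrite rev_cat (rev_cons y L) => h; exists (rev L); [exact: h | move=> v].
  by rewrite -iL !inE mem_rcons !inE mem_rev.
case/lastP: L yL hL iL {ex} => // L a _ hL iL; rewrite last_rcons => /eqP ya.
by rewrite -{}ya in hL iL; exists L.
Qed.

Lemma ipath_nth x0 p : ipath p -> forall i j, i < size p -> j < size p ->
  e (nth x0 p i) (nth x0 p j) = (i.+1 == j) || (j.+1 == i).
Proof.
elim: p => // x p IH h [|i] [|j]; have /ipath_cons[xp ex hp] := h => /=.
- by rewrite e_irr.
- rewrite ltnS => _ js; rewrite ex ?mem_nth //.
  have -> : head (nth x0 p j) p = nth x0 p 0 by case: (p) js.
  rewrite nth_uniq ?ipath_uniq //; last by case: (p) js.
  by rewrite orbF !eqSS eq_sym.
- rewrite ltnS => js _; rewrite e_sym ex ?mem_nth //.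
  have -> : head (nth x0 p i) p = nth x0 p 0 by case: (p) js.
  rewrite nth_uniq ?ipath_uniq //; last by case: (p) js.
  by rewrite !eqSS eq_sym.
- by rewrite !ltnS => ? ?; rewrite IH.
Qed.

Lemma nth_ipath p : uniq p -> (forall x0 i j, i < size p -> j < size p ->
  e (nth x0 p i) (nth x0 p j) = (i.+1 == j) || (j.+1 == i)) -> ipath p.
Proof.
elim: p => // x p IH /= /andP[xp up] h; apply/ipath_cons; split=> //.
  move=> v vp; have ip : index v p < size p by rewrite index_mem.
  have := h v 0 (index v p).+1 isT ip; rewrite /= nth_index // => ->.
  rewrite orbF !eqSS; case: p vp {IH xp up h ip} => //= a p _.
  by rewrite [a == v]eq_sym; case: (v == a).
apply: IH => // x0 i j ip jp; exact: (h x0 i.+1 j.+1 ip jp).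
Qed.

Lemma induced_pathP p : induced_path e p <-> 0 < size p /\ ipath p.
Proof.
split=> [[p0 [up h]]|[p0 hp]]; first by split=> //; apply: nth_ipath.
by split=> //; split; [exact: ipath_uniq | move=> x0; apply: ipath_nth].
Qed.

Lemma next_nth_idx x0 p i : uniq p -> i < size p ->
  next p (nth x0 p i) = nth x0 p (if i.+1 == size p then 0 else i.+1).
Proof.
move=> up ip; rewrite next_nth mem_nth // index_uniq //.
case: p up ip => // a p _ /= ip.
case: eqP => [[->]|ne]; first by rewrite nth_default.
by apply: set_nth_default; lia.
Qed.

(** Both directions reduce to arithmetic on positions: [next] raises the position by one and wraps
    to 0 at the end, and the vertex at position 0 is the one singled out by [ihole]. *)
Lemma holeP K : hole e K <-> ihole K.
Proof.
split.
  case=> s4 [uK hK]; case: K s4 uK hK => // x L s4 uK hK.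
  have nK x0 i j : i <= size L -> j <= size L -> e (nth x0 (x :: L) i) (nth x0 (x :: L) j) =
    (j == if i == size L then 0 else i.+1) || (i == if j == size L then 0 else j.+1).
    have E k : (k.+1 == size (x :: L)) = (k == size L) by [].
    move=> ip jp; rewrite hK ?mem_nth // !next_nth_idx // !E !nth_uniq //; case: ifP;
        rewrite /= ?ltnS; lia.
  move: s4 uK => /= s4 /andP[xL uL]; split=> //.
    apply: nth_ipath => // x0 i j ip jp.
    by have := nK x0 i.+1 j.+1 ip jp => /= ->; do 2 case: ifP; lia.
  move=> v vL; have ip : index v L < size L by rewrite index_mem.
  have := nK v 0 (index v L).+1 isT ip; rewrite /= nth_index // => ->.
  rewrite -nth0 -nth_last.
  have L0 : 0 < size L by lia.
  have Ll : (size L).-1 < size L by lia.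
  have hh k : k < size L -> (v == nth v L k) = (index v L == k).
    by move=> kL; rewrite -{1}(nth_index v vL) nth_uniq.
  rewrite !hh //.
  by do 2 case: ifP; lia.
case: K => // x L [s3 xL hL ex].
have uK : uniq (x :: L) by rewrite /= xL ipath_uniq.
split=> //; split=> // u v uK' vK'.
rewrite -(nth_index u uK') -(nth_index u vK').
have := uK'; have := vK'; rewrite -!index_mem.
move: (index u _) (index v _) => i j jp ip.
have E k : (k.+1 == size (x :: L)) = (k == size L) by [].
rewrite !next_nth_idx // !E !nth_uniq //; try by move: ip jp; case: ifP; rewrite /= ?ltnS; lia.
have L0 : 0 < size L by lia.
have Ll : (size L).-1 < size L by lia.
have hl k : k < size L -> e x (nth u L k) = (k == 0) || (k == (size L).-1).
  move=> kp; rewrite ex ?mem_nth // -nth0 -nth_last.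
  rewrite (set_nth_default u) // [X in _ || (_ == X)](set_nth_default u) //.
  by rewrite !nth_uniq ?ipath_uniq.
case: i j ip jp => [|i] [|j] /= ip jp.
- by rewrite e_irr; case: ifP; lia.
- by rewrite hl //; do 2 case: ifP; lia.
- by rewrite e_sym hl //; do 2 case: ifP; lia.
- by rewrite ipath_nth //; do 2 case: ifP; lia.
Qed.

End Cycles.

(** * Thetas, pyramids, prisms and turtles from a hole and a path *)

Section ThreePaths.
Variables (T : finType) (e : rel T).
Hypotheses (e_sym : symmetric e) (e_irr : irreflexive e).
Implicit Types (p q A B C K L Q : seq T) (u v x y h t : T).

Local Notation ipath := (ipath e).
Local Notation ihole := (ihole e).

Lemma ihole_uniq K : ihole K -> uniq K.
Proof. by case: K => // x L [_ /= -> /ipath_uniq]. Qed.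

Lemma induces_holeU K p q : ihole K -> K =i p ++ q ->
  induces_hole e (vset p :|: vset q).
Proof.
move=> /(holeP e_sym e_irr) hK iK; exists K; split=> //.
by apply/setP=> v; rewrite !inE iK mem_cat.
Qed.

Lemma path_fromP p u v : ipath p -> ohead p = Some u -> last u p = v ->
  path_from e p u v.
Proof.
move=> hp ep lp; split=> //; apply/(induced_pathP e_sym e_irr); split=> //.
by case: p ep {hp lp}.
Qed.

Lemma uniq_catP A B v : uniq (A ++ B) -> v \in A -> v \notin B.
Proof.
by rewrite cat_uniq => /and3P[_ /hasPn h _] vA; apply/negP => /h /=; rewrite vA.
Qed.

(** The attachments are stated from the new path [Q] to the old arc [A], the direction in which they
    are known whenever a path is hung on a hole. *)
Lemma ihole_arc A Q : A != [::] -> Q != [::] -> 4 <= size A + size Q ->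
  ipath A -> ipath Q ->
  (forall z v, z \in Q -> v \in A -> (z != v) /\
     e z v = (z == head z Q) && (v == last v A) || (z == last z Q) && (v == head v A)) ->
  ihole (A ++ Q).
Proof.
move=> A0 Q0 s4 hA hQ att; apply/ihole_cat=> //; split=> // u v uA vQ.
have [h1 h2] := att v u vQ uA; rewrite eq_sym h1 e_sym h2; split=> //.
by rewrite andbC [X in _ || X]andbC.
Qed.

Lemma head_rev x p : head x (rev p) = last x p.
Proof. by case/lastP: p => // p y; rewrite rev_rcons last_rcons. Qed.

Lemma last_rev x p : last x (rev p) = head x p.
Proof. by case: p => // y p; rewrite rev_cons last_rcons. Qed.

Lemma rev_nil p : (rev p == [::]) = (p == [::]).
Proof. by rewrite -!size_eq0 size_rev. Qed.

(** The three paths from [h] to [t] have interiors [A], [B] and [Q]; [Q] is listed from [t] back to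
    [h]. Each interior is nonempty, so any two of the paths close up to at least four vertices. *)
Lemma theta_of h t A B Q : ihole (h :: A ++ t :: B) ->
  A != [::] -> B != [::] -> Q != [::] -> ipath Q ->
  (forall z v, z \in Q -> v \in h :: A ++ t :: B ->
     (z != v) /\ e z v = (z == last z Q) && (v == h) || (z == head z Q) && (v == t)) ->
  theta e.
Proof.
move=> hK A0 B0 Q0 hQ att.
have [sA sB sQ] : [/\ 0 < size A, 0 < size B & 0 < size Q] by rewrite !lt0n !size_eq0.
have uK := ihole_uniq hK.
have dQ z : z \in Q -> z \notin h :: A ++ t :: B.
  by move=> zQ; apply/negP=> zK; have [/eqP] := att z z zQ zK.
have hK2 : ihole ((t :: rcons B h) ++ A).
  by rewrite /= cat_rcons; exact: (ihole_catC e_sym (p := h :: A) (q := t :: B) hK).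
have hK1 : ihole ((h :: rcons A t) ++ B) by rewrite /= cat_rcons.
have [s1 p1 _ _] : [/\ 4 <= size (h :: rcons A t) + size B, ipath (h :: rcons A t),
    ipath B & cyclically_linked e (h :: rcons A t) B] by apply/ihole_cat.
have [s2 p2 _ _] : [/\ 4 <= size (t :: rcons B h) + size A, ipath (t :: rcons B h),
    ipath A & cyclically_linked e (t :: rcons B h) A] by apply/ihole_cat.
have i1 v : v \in h :: rcons A t -> v \in h :: A ++ t :: B.
  rewrite !(inE, mem_cat, mem_rcons).
  by case: (v == h); case: (v == t); case: (v \in A); case: (v \in B).
have i2 v : v \in t :: rcons B h -> v \in h :: A ++ t :: B.
  rewrite !(inE, mem_cat, mem_rcons).
  by case: (v == h); case: (v == t); case: (v \in A); case: (v \in B).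
have hh : h \in h :: A ++ t :: B by rewrite inE eqxx.
have tt : t \in h :: A ++ t :: B by rewrite !inE mem_cat !inE eqxx !orbT.
have hnt : h != t.
  by apply: contraTneq uK => ->; rewrite /= mem_cat inE eqxx orbT.
have hQh : linked e Q [:: h].
  move=> z v zQ; rewrite inE => /eqP->; have [-> ->] := att z h zQ hh; split=> //=.
  by rewrite eqxx (negbTE hnt) andbF orbF.
have tQ : linked e [:: t] (rcons Q h).
  move=> v z; rewrite inE => /eqP->; rewrite mem_rcons inE => /predU1P[->|zQ].
    have [hne he] : (h != t) /\ e h t = false.
      split=> //; have : h \in h :: rcons A t by rewrite inE eqxx.
      have /ipath_cons[_ ex _] := p1; rewrite ex ?mem_rcons ?inE ?eqxx //.
      case: (A) A0 uK => // a A' _; rewrite /= mem_cat inE => /and3P[_ + _] _.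
      by rewrite negb_or => /andP[_]; rewrite eq_sym inE negb_or => /andP[/negbTE].
    rewrite eq_sym hne e_sym he; split=> //; rewrite eqxx.
    case: (Q) Q0 dQ => // a Q' _ /(_ a (mem_head _ _)); rewrite inE negb_or eq_sym.
    by case/andP=> /negbTE ->.
  have [h1 h2] := att z t zQ tt; rewrite eq_sym h1 e_sym h2; split=> //.
  rewrite [t == h]eq_sym (negbTE hnt) andbF /= !eqxx andbT.
  by case: (Q) zQ.
have p3 : ipath (t :: rcons Q h).
  apply/(@ipath_cat _ e [:: t]); split=> //; rewrite -cats1.
  by apply/ipath_cat; split.
exists h, t, (h :: rcons A t), (rev (t :: rcons B h)), (rev (t :: rcons Q h)).
have r X : rev (t :: rcons X h) = h :: rcons (rev X) t by rewrite rev_cons rev_rcons.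
(* Disjointness is recorded as boolean implications, so that the set equations below follow by case
   analysis on the memberships of [v]. *)
have fA v : (v \in A) ==> [&& v != h, v != t & v \notin B].
  apply/implyP; move: uK; rewrite cons_uniq => /andP[hn /uniq_catP uu] vA.
  have := uu v vA; rewrite inE negb_or => /andP[-> ->]; rewrite !andbT.
  by apply: contraNneq hn => <-; rewrite mem_cat vA.
have fB v : (v \in B) ==> [&& v != h & v != t].
  apply/implyP; move: uK; rewrite cons_uniq cat_uniq /= => /andP[hn /and4P[_ _ tB _]] vB.
  apply/andP; split; last by apply: contraNneq tB => <-.
  by apply: contraNneq hn => <-; rewrite mem_cat inE vB !orbT.
have fQ v : (v \in Q) ==> [&& v != h, v != t, v \notin A & v \notin B].
  by apply/implyP => /dQ; rewrite !inE mem_cat !inE !negb_or => /and4P[-> -> -> ->].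
have fht v : (v == h) ==> (v != t) by apply/implyP => /eqP->.
split; first split=> //.
- have /ipath_cons[_ ex _] := p1; rewrite ex ?mem_rcons ?inE ?eqxx //.
  case: (A) A0 fA => // a A' _ /(_ a); rewrite mem_head /= => /and3P[_ + _].
  by rewrite eq_sym.
- by apply: path_fromP => //=; rewrite last_rcons.
- by apply: path_fromP; rewrite ?ipath_rev // r //= last_rcons.
- by apply: path_fromP; rewrite ?ipath_rev // r //= last_rcons.
split; first split.
- apply/setP=> v; rewrite !r !(inE, mem_rcons, mem_rev).
  move: (fA v) (fB v) (fQ v) (fht v).
  by case: (v == h); case: (v == t); case: (v \in A); case: (v \in B); case: (v \in Q).
- apply/setP=> v; rewrite !r !(inE, mem_rcons, mem_rev).
  move: (fA v) (fB v) (fQ v) (fht v).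
  by case: (v == h); case: (v == t); case: (v \in A); case: (v \in B); case: (v \in Q).
- apply/setP=> v; rewrite !r !(inE, mem_rcons, mem_rev).
  move: (fA v) (fB v) (fQ v) (fht v).
  by case: (v == h); case: (v == t); case: (v \in A); case: (v \in B); case: (v \in Q).
split.
- apply: (induces_holeU hK) => v; rewrite !r !(inE, mem_cat, mem_rcons, mem_rev).
  by case: (v == h); case: (v == t); case: (v \in A); case: (v \in B).
- apply: (@induces_holeU ((h :: rcons A t) ++ Q)).
    apply/ihole_cat => //; split=> //.
      by rewrite /= size_rcons; move: sA sQ; clear; lia.
    move=> u v /i1 uK1 vQ; have [h1 h2] := att v u vQ uK1.
    rewrite eq_sym h1 e_sym h2 /= last_rcons; split=> //.
    by rewrite orbC andbC [X in _ || X]andbC.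
  move=> v; rewrite !r !(inE, mem_cat, mem_rcons, mem_rev).
  by case: (v == h); case: (v == t); case: (v \in A); case: (v \in Q).
- apply: (@induces_holeU ((t :: rcons B h) ++ rev Q)).
    apply/ihole_cat => //; first by rewrite -size_eq0 size_rev size_eq0.
    split; rewrite ?ipath_rev //.
      by rewrite size_rev /= size_rcons; move: sB sQ; clear; lia.
    move=> u v /i2 uK1; rewrite mem_rev => vQ; have [h1 h2] := att v u vQ uK1.
    rewrite eq_sym h1 e_sym h2 /= last_rcons; split=> //.
    rewrite andbC [X in _ || X]andbC; congr (_ && _ || _ && _); congr (_ == _).
      by case/lastP: (Q) Q0 => // ? ? _; rewrite rev_rcons last_rcons.
    by case: (Q) Q0 => // ? ? _; rewrite rev_cons last_rcons.
  move=> v; rewrite !r !(inE, mem_cat, mem_rcons, mem_rev).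
  by case: (v == h); case: (v == t); case: (v \in B); case: (v \in Q).
Qed.

Lemma ihole_catl p q : p != [::] -> q != [::] -> ihole (p ++ q) -> ipath p.
Proof. by move=> p0 q0 /ihole_cat[]. Qed.

(** The apex is [h]; the triangle consists of the last vertices of [A] and [Q] and the first of [B].
    The condition on sizes says that the cycles [h A Q] and [h B Q] have length at least four: a
    single vertex [Q] requires two vertices in each of [A] and [B]. *)
Lemma pyramid_of h A B Q : ihole (h :: A ++ B) ->
  A != [::] -> B != [::] -> 2 <= size Q \/ (1 <= size Q /\ 2 <= size A /\ 2 <= size B) ->
  ipath Q ->
  (forall z v, z \in Q -> v \in h :: A ++ B -> (z != v) /\
     e z v = (z == head z Q) && (v == h) ||
             (z == last z Q) && ((v == last v A) || (v == head v B))) ->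
  pyramid e.
Proof.
move=> hK A0 B0 sQ hQ att.
have Q0 : Q != [::] by case: (Q) sQ => // -[//|[]].
have A1 : 0 < size A by rewrite lt0n size_eq0.
have B1 : 0 < size B by rewrite lt0n size_eq0.
have := ihole_uniq hK; rewrite cons_uniq mem_cat negb_or => /andP[/andP[hA hB] uAB].
have dQ z : z \in Q -> z \notin h :: A ++ B.
  by move=> zQ; apply/negP=> zK; have [/eqP] := att z z zQ zK.
have p1 : ipath (h :: A) by apply: (@ihole_catl _ B).
have hK2 : ihole (rcons B h ++ A).
  by rewrite cat_rcons; apply: (ihole_catC e_sym (p := h :: A)).
have p2 : ipath (rcons B h) by apply: ihole_catl hK2 => //; case: (B).
have i1 v : v \in h :: A -> v \in h :: A ++ B.
  by rewrite !inE mem_cat orbA => ->.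
have i2 v : v \in rcons B h -> v \in h :: A ++ B.
  by rewrite mem_rcons !inE mem_cat => /orP[] -> //; rewrite !orbT.
have eBh v : v \in A -> v == head v B = false.
  move=> vA; apply/eqP => vB; have := uniq_catP uAB vA.
  by rewrite vB; case: (B) B0 => // b B' _; rewrite mem_head.
have eAh v : v \in B -> v == last v A = false.
  move=> vB; apply/eqP => vA; have := contraL (@uniq_catP A B v uAB) vB.
  by rewrite vA; case: (A) A0 => // b B' _; rewrite /= mem_last.
have h1 : ihole ((h :: A) ++ rev Q).
  apply: ihole_arc; rewrite ?rev_nil ?ipath_rev //.
    by rewrite size_rev /=; case: sQ; move: A1; clear; lia.
  move=> z v; rewrite mem_rev => zQ vA; have [-> ->] := att z v zQ (i1 v vA).
  split=> //; rewrite head_rev last_rev /= orbC; congr (_ && _ || _).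
  move: vA; rewrite inE => /predU1P[->|vA].
    case: (A) (A0) (hA) => // a A' _ hA'; case: eqP => [lh|_].
      by rewrite lh /= mem_last in hA'.
    by case: (B) B0 hB => // b B' _; rewrite inE negb_or => /andP[/negbTE].
  by rewrite eBh // orbF; case: (A) vA.
have h2 : ihole (rcons B h ++ Q).
  apply: ihole_arc => //; first by case: (B).
    by rewrite size_rcons; case: sQ; move: B1; clear; lia.
  move=> z v zQ vB; have [-> ->] := att z v zQ (i2 v vB).
  split=> //; rewrite last_rcons; congr (_ || _ && _).
  have -> : head v (rcons B h) = head v B by case: (B) B0.
  move: vB; rewrite mem_rcons inE => /predU1P[->|vB]; last by rewrite eAh.
  case: (A) (A0) (hA) => // a A' _ hA'; case: eqP => // lh.
  by rewrite lh /= mem_last in hA'.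
exists h, (last h A), (head h B), (last h Q), (h :: A), (rev (rcons B h)), (h :: Q).
have lQ : last h Q \in Q by case: (Q) Q0 => // a b _; rewrite /= mem_last.
have hBB : head h B \in B by case: (B) B0 => // a b _; rewrite mem_head.
have lAA : last h A \in A by case: (A) A0 => // a b _; rewrite /= mem_last.
have elQ z : last z Q = last h Q by case: (Q) Q0.
have elA z : last z A = last h A by case: (A) A0.
have ehB z : head z B = head h B by case: (B) B0.
have fA v : (v \in A) ==> [&& v != h & v \notin B].
  by apply/implyP => vA; rewrite (uniq_catP uAB vA) andbT; apply: contraNneq hA => <-.
have fB v : (v \in B) ==> (v != h).
  by apply/implyP => vA; apply: contraNneq hB => <-.
have fQ v : (v \in Q) ==> [&& v != h, v \notin A & v \notin B].
  by apply/implyP => /dQ; rewrite !inE mem_cat !negb_or.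
split; first split.
- have [_ _ _ l] : [/\ 4 <= size (h :: A) + size B, ipath (h :: A), ipath B
    & cyclically_linked e (h :: A) B] by apply/ihole_cat.
  have [_ ->] := l (last h A) (head h B) (mem_last h A) hBB.
  by rewrite /= ehB !eqxx.
- have [|_] := att (last h Q) (last h A) lQ; first by rewrite inE mem_cat lAA orbT.
  by rewrite e_sym => ->; rewrite elQ elA !eqxx /= orbT.
- have [|_] := att (last h Q) (head h B) lQ; first by rewrite inE mem_cat hBB !orbT.
  by rewrite e_sym => ->; rewrite elQ ehB !eqxx /= !orbT.
split; first split.
- exact: path_fromP.
- apply: path_fromP; rewrite ?ipath_rev ?rev_rcons //=.
  by rewrite last_rev.
- apply: path_fromP => //; apply/ipath_cons; split=> //.
    by apply/negP => /dQ; rewrite inE eqxx.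
  move=> z zQ; rewrite e_sym; have [|_ ->] := att z h zQ; first by rewrite inE eqxx.
  rewrite eqxx andbT [h == last _ _]eq_sym.
  have -> : last h A == h = false.
    by apply: contraNF hA => /eqP <-.
  rewrite [h == head _ _]eq_sym; have -> : head h B == h = false.
    by apply: contraNF hB => /eqP <-.
  by rewrite andbF orbF.
split; first split.
- apply/setP=> v; rewrite !(inE, mem_rcons, mem_rev); move: (fA v) (fB v) (fQ v).
  by case: (v == h); case: (v \in A); case: (v \in B); case: (v \in Q).
- apply/setP=> v; rewrite !(inE, mem_rcons, mem_rev); move: (fA v) (fB v) (fQ v).
  by case: (v == h); case: (v \in A); case: (v \in B); case: (v \in Q).
- apply/setP=> v; rewrite !(inE, mem_rcons, mem_rev); move: (fA v) (fB v) (fQ v).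
  by case: (v == h); case: (v \in A); case: (v \in B); case: (v \in Q).
split.
- apply: (induces_holeU hK) => v; rewrite !(inE, mem_cat, mem_rcons, mem_rev).
  by case: (v == h); case: (v \in A); case: (v \in B).
- apply: (induces_holeU h1) => v; rewrite !(inE, mem_cat, mem_rcons, mem_rev).
  by case: (v == h); case: (v \in A); case: (v \in Q).
- apply: (induces_holeU h2) => v; rewrite !(inE, mem_cat, mem_rcons, mem_rev).
  by case: (v == h); case: (v \in B); case: (v \in Q).
Qed.

(** One triangle lies where [A] meets [B], the other where [B] closes back to [A]; [Q] joins them.
    Each path needs two vertices because the triangles must be disjoint. *)
Lemma prism_of A B Q : ihole (A ++ B) ->
  2 <= size A -> 2 <= size B -> 2 <= size Q -> ipath Q ->
  (forall z v, z \in Q -> v \in A ++ B -> (z != v) /\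
     e z v = (z == head z Q) && ((v == last v A) || (v == head v B)) ||
             (z == last z Q) && ((v == head v A) || (v == last v B))) ->
  prism e.
Proof.
move=> hK sA sB sQ hQ att.
have A0 : A != [::] by case: (A) sA.
have B0 : B != [::] by case: (B) sB.
have Q0 : Q != [::] by case: (Q) sQ.
have [x _] : exists x, x \in A by case: (A) A0 => // a A' _; exists a; rewrite mem_head.
have uAB := ihole_uniq hK.
have dQ z : z \in Q -> z \notin A ++ B.
  by move=> zQ; apply/negP=> zK; have [/eqP] := att z z zQ zK.
have [s4 pA pB l] : [/\ 4 <= size A + size B, ipath A, ipath B
  & cyclically_linked e A B] by apply/ihole_cat.
have mem2 X : 2 <= size X -> uniq X ->
    [/\ head x X \in X, last x X \in X, head x X != last x X,
      forall z, head z X = head x X & forall z, last z X = last x X].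
  case: X => [|a [|b X]] //= _ /andP[aX _]; split=> //; rewrite ?mem_head //.
    by rewrite inE mem_last orbT.
  by apply: contraNneq aX => ->; rewrite mem_last.
have [hAA lAA nA ehA elA] := mem2 A sA (ipath_uniq pA).
have [hBB lBB nB ehB elB] := mem2 B sB (ipath_uniq pB).
have [hQQ lQQ nQ ehQ elQ] := mem2 Q sQ (ipath_uniq hQ).
have eBA v u : v \in A -> u \in B -> (v == u) = false.
  by move=> vA uB; apply/eqP => vu; have := uniq_catP uAB vA; rewrite vu uB.
have h1 : ihole (A ++ Q).
  apply: ihole_arc => //; first by move: sA sQ; clear; lia.
  move=> z v zQ vA; have [|-> ->] := att z v zQ; first by rewrite mem_cat vA.
  by split=> //; rewrite ehB elB (eBA v (head x B)) // (eBA v (last x B)) // !orbF.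
have h2 : ihole (B ++ rev Q).
  apply: ihole_arc; rewrite ?rev_nil ?ipath_rev ?size_rev //; first by move: sB sQ; clear; lia.
  move=> z v; rewrite mem_rev => zQ vB; have [|-> ->] := att z v zQ;
      first by rewrite mem_cat vB orbT.
  by split=> //; rewrite ehA elA !(eq_sym v (_ x A)) (eBA (head x A)) // (eBA (last x A)) //=
      head_rev last_rev orbC.
have fA v : (v \in A) ==> (v \notin B).
  by apply/implyP => vA; rewrite (uniq_catP uAB vA).
have fQ v : (v \in Q) ==> [&& v \notin A & v \notin B].
  by apply/implyP => /dQ; rewrite mem_cat negb_or.
have iA v : v \in A -> v \in A ++ B by rewrite mem_cat => ->.
have iB v : v \in B -> v \in A ++ B by rewrite mem_cat orbC => ->.
exists (last x A), (head x B), (head x Q), (head x A), (last x B), (last x Q),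
  (rev A), B, Q.
split; first split.
- by have [_ ->] := l _ _ lAA hBB; rewrite ehB elA !eqxx.
- by rewrite e_sym; have [_ ->] := att _ _ hQQ (iA _ lAA); rewrite ehQ elA !eqxx.
- by rewrite e_sym; have [_ ->] := att _ _ hQQ (iB _ hBB); rewrite ehQ ehB !eqxx orbT.
split; first split.
- by have [_ ->] := l _ _ hAA lBB; rewrite ehA elB !eqxx orbT.
- by rewrite e_sym; have [_ ->] := att _ _ lQQ (iA _ hAA); rewrite elQ ehA !eqxx orbT.
- by rewrite e_sym; have [_ ->] := att _ _ lQQ (iB _ lBB); rewrite elQ elB !eqxx !orbT.
split.
  have eQ u v : u \in Q -> v \in A ++ B -> (u == v) = false.
    by move=> uQ vK; apply/eqP => uv; have := dQ u uQ; rewrite uv vK.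
  apply/setP => v; rewrite !inE; apply/negP => /andP[/orP[/orP[]|] /eqP-> /orP[/orP[]|]].
  - by rewrite eq_sym (negbTE nA).
  - by rewrite eBA.
  - by rewrite eq_sym eQ ?iA.
  - by rewrite eq_sym eBA.
  - by rewrite (negbTE nB).
  - by rewrite eq_sym eQ ?iB.
  - by rewrite eQ ?iA.
  - by rewrite eQ ?iB.
  - by rewrite (negbTE nQ).
split; first split.
- apply: path_fromP; rewrite ?ipath_rev ?last_rev //.
  by case/lastP: (A) A0 => // ? ? _; rewrite rev_rcons last_rcons.
- by apply: path_fromP => //; case: (B) B0.
- by apply: path_fromP => //; case: (Q) Q0.
split; first split.
- apply/setP=> v; rewrite !(inE, mem_rev); move: (fA v) (fQ v).
  by case: (v \in A); case: (v \in B); case: (v \in Q).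
- apply/setP=> v; rewrite !(inE, mem_rev); move: (fA v) (fQ v).
  by case: (v \in A); case: (v \in B); case: (v \in Q).
- apply/setP=> v; rewrite !(inE, mem_rev); move: (fA v) (fQ v).
  by case: (v \in A); case: (v \in B); case: (v \in Q).
split.
- by apply: (induces_holeU hK) => v; rewrite !(mem_cat, mem_rev).
- by apply: (induces_holeU h1) => v; rewrite !(mem_cat, mem_rev).
- by apply: (induces_holeU h2) => v; rewrite !(mem_cat, mem_rev).
Qed.

Lemma card_count (f : pred T) A : uniq A -> #|[set v in A | f v]| = count f A.
Proof.
move=> uA; rewrite -size_filter -(card_uniqP (filter_uniq f uA)).
by apply: eq_card => v; rewrite !inE mem_filter andbC.
Qed.

Lemma turtle_of A B x y : ihole (A ++ B) -> e x y ->
  3 <= count (e x) A -> 3 <= count (e y) B -> ~~ has (e x) B -> ~~ has (e y) A ->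
  turtle e.
Proof.
move=> hK exy cA cB /hasPn nB /hasPn nA.
have sA : 3 <= size A by apply: leq_trans cA (count_size _ _).
have sB : 3 <= size B by apply: leq_trans cB (count_size _ _).
have A0 : A != [::] by case: (A) sA.
have B0 : B != [::] by case: (B) sB.
have uAB := ihole_uniq hK.
have [s4 pA pB l] : [/\ 4 <= size A + size B, ipath A, ipath B
  & cyclically_linked e A B] by apply/ihole_cat.
exists (head x A), (last x A), (last x B), (head x B), x, y, A, (rev B).
split; first split.
- by apply: path_fromP => //; case: (A) A0.
- apply: path_fromP; rewrite ?ipath_rev ?last_rev //.
    by case/lastP: (B) B0 => // ? ? _; rewrite rev_rcons last_rcons.
  by case: (B) B0.
- apply/setP => v; rewrite !inE mem_rev; apply/andP => -[vA].
  by rewrite (negbTE (uniq_catP uAB vA)).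
have hAA : head x A \in A by case: (A) A0 => // a b _; rewrite mem_head.
have lAA : last x A \in A by case: (A) A0 => // a b _; rewrite /= mem_last.
have hBB : head x B \in B by case: (B) B0 => // a b _; rewrite mem_head.
have lBB : last x B \in B by case: (B) B0 => // a b _; rewrite /= mem_last.
split; first split.
- have [_ ->] := l _ _ hAA lBB; case: (A) (B) A0 B0 => // ? ? [|? ?] //= _ _.
  by rewrite !eqxx orbT.
- have [_ ->] := l _ _ lAA hBB; case: (A) (B) A0 B0 => // ? ? [|? ?] //= _ _.
  by rewrite !eqxx.
- by apply: (induces_holeU hK) => v; rewrite !(mem_cat, mem_rev).
split=> //; split.
- by rewrite card_count // (ipath_uniq pA).
- apply/setP => v; rewrite !inE mem_rev; apply/andP => -[vB exv].
  by have := nB v vB; rewrite exv.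
- by rewrite card_count ?count_rev // rev_uniq (ipath_uniq pB).
- apply/setP => v; rewrite !inE; apply/andP => -[vB exv].
  by have := nA v vB; rewrite exv.
Qed.

End ThreePaths.

(** * Connected sets attached to a hole *)

Section Attach.
Variables (T : finType) (e : rel T).
Hypotheses (e_sym : symmetric e) (e_irr : irreflexive e).
Hypotheses (no_theta : ~ theta e) (no_pyramid : ~ pyramid e).
Hypotheses (no_prism : ~ prism e) (no_turtle : ~ turtle e).
Implicit Types (p A B C K L Q : seq T) (q u v x y h t : T).

Local Notation ipath := (ipath e).
Local Notation ihole := (ihole e).

Lemma split_first (f : pred T) p : has f p ->
  exists A c B, [/\ p = A ++ c :: B, f c & ~~ has f A].
Proof.
by case/split_find=> c A B fc nA; exists A, c, B; rewrite -cat_rcons.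
Qed.

Lemma split_last (f : pred T) p : has f p ->
  exists A c B, [/\ p = A ++ c :: B, f c & ~~ has f B].
Proof.
rewrite -has_rev => /split_first[A [c [B [ep fc nA]]]].
exists (rev B), c, (rev A); rewrite has_rev; split=> //.
by rewrite -[p]revK ep rev_cat rev_cons cat_rcons.
Qed.

Lemma split_ends (f : pred T) p : has f p ->
  (exists A c B, [/\ p = A ++ c :: B, f c, ~~ has f A & ~~ has f B]) \/
  (exists A c M d B, [/\ p = A ++ c :: M ++ d :: B, f c, f d, ~~ has f A & ~~ has f B]).
Proof.
case/split_first=> A [c [B [-> fc nA]]].
have [/split_last[M [d [C [-> fd nC]]]]|nB] := boolP (has f B).
  by right; exists A, c, M, d, C.
by left; exists A, c, B.
Qed.

(** Given such a path from the second vertex on, [q] is prepended. If [q] already occurs there, the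
    path is cut at that occurrence; otherwise [q] jumps to its last neighbour on it. Either way the
    end, the only vertex satisfying [f], is kept. *)
Lemma shortest_path (f : pred T) q p : path e q p -> has f (q :: p) ->
  exists Q, [/\ ipath (q :: Q), {subset q :: Q <= q :: p} &
    {in q :: Q, forall v, f v = (v == last q Q)}].
Proof.
elim: p q => [|r p IH] q /=.
  rewrite orbF => _ fq; exists [::]; split=> // v.
  by rewrite inE => /eqP->; rewrite fq eqxx.
case/andP=> qr pr hf.
have [fq|nfq] := boolP (f q).
  exists [::]; split=> //; first by move=> v; rewrite !inE => ->.
  by move=> v; rewrite inE => /eqP->; rewrite fq eqxx.
rewrite (negbTE nfq) /= in hf.
have [Q [hQ sQ fQ]] := IH r pr hf.
have [qQ|nqQ] := boolP (q \in r :: Q).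
  case/splitPr: {-1}(r :: Q) / qQ (erefl (r :: Q)) => A B eQ.
  have lQ : last r Q = last q B by rewrite -[last r Q]/(last q (r :: Q)) eQ last_cat.
  exists B; split=> [|v vB|v vB].
  - by rewrite eQ in hQ; case/ipath_cat: hQ.
  - by rewrite inE sQ ?orbT // eQ mem_cat vB orbT.
  - by rewrite fQ ?lQ // eQ mem_cat vB orbT.
have /split_last[A [v [B [eQ qv nB]]]] : has (e q) (r :: Q) by rewrite /= qr.
have lQ : last r Q = last v B by rewrite -[last r Q]/(last q (r :: Q)) eQ last_cat.
have iB u : u \in v :: B -> u \in r :: Q by rewrite eQ mem_cat orbC => ->.
exists (v :: B); split=> [|u|u].
- apply/ipath_cons; split.
  + by apply: contra nqQ => /iB.
  + move=> u; rewrite inE /= => /predU1P[->|uB]; first by rewrite qv eqxx.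
    rewrite (negbTE (hasPn nB u uB)); apply/esym/eqP => uv.
    have : ipath (v :: B) by rewrite eQ in hQ; case/ipath_cat: hQ.
    by case/ipath_cons; rewrite -uv uB.
  + by rewrite eQ in hQ; case/ipath_cat: hQ.
- by rewrite inE => /predU1P[->|/iB/sQ uQ]; rewrite inE ?eqxx // uQ orbT.
- rewrite inE => /predU1P[->|uB] /=; last by rewrite fQ ?lQ // iB.
  rewrite (negbTE nfq) -lQ; apply/esym/eqP => ql.
  by case/negP: nqQ; rewrite ql mem_last.
Qed.

Lemma ihole_cycP A B : A != [::] -> B != [::] -> ihole (A ++ B) ->
  [/\ 4 <= size A + size B, ipath A, ipath B & cyclically_linked e A B].
Proof. by move=> p0 q0 /ihole_cat[]. Qed.

(* A connected set hung on the hole at [u] and, through [q] alone, elsewhere: the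
   extreme neighbours of [q] along [L] give a theta, or a pyramid when they are
   adjacent. *)
Lemma attach_vertex u L q p : ihole (u :: L) -> path e q p ->
  (forall v, v \in q :: p -> v \notin u :: L) ->
  ~~ e u q -> has (e u) p -> has (fun c => e q c && ~~ e u c) L ->
  (forall v, v \in p -> ~~ has (e v) L) -> False.
Proof.
move=> hK wp dK nuq hup /hasP[c0 c0L /andP[qc0 nuc0]] anti.
have := @shortest_path (e u) q p wp; rewrite /= hup orbT.
case=> // Q [hQ sQ uQ].
have pL v : v \in q :: Q -> v != q -> v \in p.
  by move/sQ; rewrite inE => /predU1P[->|//]; rewrite eqxx.
have lqQ : last q Q != q.
  by apply: contraNneq nuq => lq; rewrite uQ ?mem_head // lq.
have Q0 : Q != [::] by case: (Q) lqQ; rewrite //= eqxx.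
have aQ v c : v \in q :: Q -> c \in L -> e v c = (v == q) && e q c.
  move=> vQ cL; have [->//|vq] := eqVneq v q.
  by apply/negbTE; apply: (hasPn (anti v (pL v vQ vq))).
have dL v c : v \in q :: Q -> c \in u :: L -> (v == c) = false.
  by move=> /sQ/dK vK cK; apply: contraNF vK => /eqP->.
have [sL uL pLL ex] := hK.
have hpL c : c \in L -> (c == u) = false.
  by move=> cL; apply: contraNF uL => /eqP <-.
have hqL : has (e q) L by apply/hasP; exists c0.
have nilL A c B : L = A ++ c :: B -> ~~ e u c -> A != [::] /\ B != [::].
  move=> eL nuc; move: (ex c); rewrite eL mem_cat inE eqxx orbT (negbTE nuc) => /(_ isT).
  rewrite last_cat /=; case: (A) => [|a A'] /=; first by rewrite eqxx.
  by case: (B) => [|b B'] //=; rewrite eqxx orbT.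
have lq : last q Q \in q :: Q by rewrite mem_last.
case: (split_ends hqL) => [[A [c [B [eL qc nA nB]]]]|[A [c [M [d [B [eL qc qd nA nB]]]]]]].
  have qL z : z \in L -> e q z = (z == c).
    rewrite eL mem_cat inE => /or3P[zA|/eqP->|zB].
    - rewrite (negbTE (hasPn nA z zA)); apply/esym/eqP => zc.
      by have := hasPn nA z zA; rewrite zc qc.
    - by rewrite qc eqxx.
    - rewrite (negbTE (hasPn nB z zB)); apply/esym/eqP => zc.
      by have := hasPn nB z zB; rewrite zc qc.
  have ec : c0 = c by apply/eqP; rewrite -qL.
  rewrite {}ec in c0L qc0 nuc0.
  have [A0 B0] := nilL _ _ _ eL nuc0.
  apply: no_theta; apply: (@theta_of _ _ e_sym e_irr u c A B (q :: Q)) => //.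
    by rewrite -eL.
  rewrite -eL => z v zQ vK; split; first by rewrite dL.
  move: vK; rewrite inE => /predU1P[->|vL] /=.
    rewrite eqxx andbT e_sym uQ //.
    have -> : (u == c) = false by rewrite eq_sym hpL.
    by rewrite andbF orbF.
  by rewrite aQ // (hpL v) // andbF qL.
have uniqL := ipath_uniq pLL.
have qL z : z \in A ++ [:: c] -> e q z = (z == c).
  rewrite mem_cat inE => /orP[zA|/eqP->]; last by rewrite qc eqxx.
  rewrite (negbTE (hasPn nA z zA)); apply/esym/eqP => zc.
  by have := hasPn nA z zA; rewrite zc qc.
have qR z : z \in d :: B -> e q z = (z == d).
  rewrite inE => /predU1P[->|zB]; first by rewrite qd eqxx.
  rewrite (negbTE (hasPn nB z zB)); apply/esym/eqP => zc.
  by have := hasPn nB z zB; rewrite zc qd.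
have [M0|M0] := eqVneq M [::].
  rewrite {}M0 /= in eL.
  have eL' : L = (A ++ [:: c]) ++ d :: B by rewrite eL -catA.
  apply: no_pyramid; apply: (@pyramid_of _ _ e_sym e_irr u (A ++ [:: c]) (d :: B) (rev (q ::
      Q))).
  - by rewrite -eL'.
  - by case: (A).
  - by [].
  - by left; rewrite size_rev; case: (Q) Q0.
  - exact: ipath_rev.
  rewrite -eL' => z v; rewrite mem_rev => zQ vK; split; first by rewrite dL.
  rewrite head_rev last_rev /= last_cat /=.
  move: vK; rewrite inE => /predU1P[->|vL].
    rewrite eqxx andbT e_sym uQ //.
    have [cL dL'] : c \in L /\ d \in L.
      by rewrite eL !mem_cat !inE !eqxx !orbT.
    by rewrite ![u == _]eq_sym !hpL // andbF orbF.
  rewrite aQ // (hpL v) // andbF /=; congr (_ && _).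
  move: vL; rewrite eL' mem_cat => /orP[vA|vB].
    rewrite qL //; have := uniq_catP (etrans (congr1 uniq (esym eL')) uniqL) vA.
    by rewrite inE negb_or => /andP[/negbTE->]; rewrite orbF.
  rewrite qR //; have [vc|//] := eqVneq v c;
      have : c \in A ++ [:: c] by rewrite mem_cat inE eqxx orbT.
  by move/(uniq_catP (etrans (congr1 uniq (esym eL')) uniqL)) => /negP[]; rewrite -vc.
have eL' : L = (A ++ [:: c]) ++ M ++ d :: B by rewrite eL -catA.
have pD : ipath ((d :: B) ++ u :: A ++ [:: c]).
  have : ihole (M ++ (d :: B) ++ u :: A ++ [:: c]).
    rewrite catA; apply: (ihole_catC e_sym (p := u :: A ++ [:: c])).
    by rewrite cat_cons -eL'.
  by case/ihole_cycP.
have iD z : z \in (d :: B) ++ u :: A ++ [:: c] -> z \in u :: L.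
  rewrite eL' !(inE, mem_cat); case: (z == d); case: (z \in B); rewrite ?orbT //=.
  by case: (z == u); case: (z \in A); case: (z == c).
(* The stretch [M] is replaced by [q], which discards every neighbour of [q] strictly between [c]
   and [d]. On the new hole, [u] and [q] become the ends of a theta with third path [Q]. *)
have hN : ihole ([:: q] ++ ((d :: B) ++ u :: A ++ [:: c])).
  apply/ihole_cat => //; split=> //.
    by rewrite /= !size_cat /= !size_cat /=; clear; lia.
  move=> z v; rewrite inE => /eqP-> vD; split.
    by rewrite dL ?mem_head // iD.
  rewrite eqxx /= !last_cat /= last_cat /=.
  move: (iD v vD); rewrite inE => /predU1P[->|vL].
    rewrite e_sym (negbTE nuq).
    have [cL dL'] : c \in L /\ d \in L.
      by rewrite eL !(inE, mem_cat) !eqxx !orbT.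
    by rewrite ![u == _]eq_sym !hpL.
  have [->|vc] := eqVneq v c; first by rewrite qc orbT.
  have [->|vd] := eqVneq v d; first by rewrite qd.
  move: vD; rewrite mem_cat => /orP[/qR->|]; first by rewrite (negbTE vd).
  rewrite inE hpL //= => /qL->; exact: negbTE.
have hN' : ihole (u :: (A ++ [:: c]) ++ q :: d :: B).
  apply: (ihole_catC e_sym (p := q :: d :: B) (q := u :: A ++ [:: c])).
  by rewrite cat_cons.
apply: no_theta; apply: (@theta_of _ _ e_sym e_irr u q (A ++ [:: c]) (d :: B) Q) => //.
- by case: (A).
- by case/ipath_cons: hQ.
have [qnQ eqQ _] : [/\ q \notin Q, {in Q, forall v, e q v = (v == head v Q)} & ipath Q].
  exact/ipath_cons.
move=> z v zQ.
have zqQ : z \in q :: Q by rewrite inE zQ orbT.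
have zq : z != q by apply: contraNneq qnQ => <-.
have lz : last z Q = last q Q by case: (Q) Q0.
rewrite -cat_cons mem_cat inE orbCA => /orP[/eqP->|].
  rewrite eqxx andbT e_sym eqQ // [q == u]eq_sym.
  have -> : (u == q) = false by rewrite eq_sym dL ?mem_head.
  by rewrite andbF.
move=> vD; have vK : v \in u :: L.
  by apply: iD; rewrite mem_cat orbC.
split; first by rewrite dL.
have vq : (v == q) = false by rewrite eq_sym dL ?mem_head.
rewrite vq andbF orbF lz.
move: vK; rewrite inE => /predU1P[->|vL].
  by rewrite eqxx andbT e_sym uQ.
by rewrite aQ // (negbTE zq) (hpL v) // andbF.
Qed.
(** The edge [v u] and the end of a shortest path [Q] form a triangle. If the extreme neighbours of
    [q] on [L] coincide, they give the apex of a pyramid; if they are adjacent, they form with [q]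
    the second triangle of a prism; if they are apart, [q] is the apex of a pyramid on the hole
    shortened through [q]. *)
Lemma attach_edge u v L q p : ihole (u :: rcons L v) -> path e q p ->
  (forall z, z \in q :: p -> z \notin u :: rcons L v) ->
  ~~ e u q -> ~~ e v q -> has (e q) L -> has (e u) p ->
  (forall z, z \in p -> e z u = e z v /\ ~~ has (e z) L) -> False.
Proof.
move=> hK wp dK nuq nvq hqL hup anti.
have := @shortest_path (e u) q p wp; rewrite /= hup orbT.
case=> // Q [hQ sQ uQ].
have pL z : z \in q :: Q -> z != q -> z \in p.
  by move/sQ; rewrite inE => /predU1P[->|//]; rewrite eqxx.
have lqQ : last q Q != q.
  by apply: contraNneq nuq => lq; rewrite uQ ?mem_head // lq.
have Q0 : Q != [::] by case: (Q) lqQ; rewrite //= eqxx.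
have euQ z : z \in q :: Q -> e z u = (z == last q Q).
  by move=> zQ; rewrite e_sym uQ.
have evQ z : z \in q :: Q -> e z v = (z == last q Q).
  move=> zQ; have [->|zq] := eqVneq z q.
    by rewrite e_sym (negbTE nvq) eq_sym (negbTE lqQ).
  by have [<- _] := anti z (pL z zQ zq); exact: euQ.
have aQ z c : z \in q :: Q -> c \in L -> e z c = (z == q) && e q c.
  move=> zQ cL; have [->//|zq] := eqVneq z q.
  by apply/negbTE; have [_ h] := anti z (pL z zQ zq); apply: (hasPn h).
have dL z c : z \in q :: Q -> c \in u :: rcons L v -> (z == c) = false.
  by move=> /sQ/dK zK cK; apply: contraNF zK => /eqP->.
have := ihole_uniq hK; rewrite /= mem_rcons rcons_uniq inE negb_or.
case/and3P=> /andP[nuv uL] vL uniqL.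
have huL c : c \in L -> (c == u) = false.
  by move=> cL; apply: contraNF uL => /eqP <-.
have hvL c : c \in L -> (c == v) = false.
  by move=> cL; apply: contraNF vL => /eqP <-.
have evu : (v == u) = false by rewrite eq_sym (negbTE nuv).
have euv : (u == v) = false by rewrite (negbTE nuv).
have [qnQ eqQ hQ'] : [/\ q \notin Q, {in Q, forall z, e q z = (z == head z Q)} & ipath Q].
  exact/ipath_cons.
have inK z : z \in u :: rcons L v -> [\/ z = u, z = v | z \in L].
  rewrite inE mem_rcons inE => /or3P[/eqP|/eqP|];
      by [constructor 1|constructor 2|constructor 3].
have vK : v \in u :: rcons L v by rewrite inE mem_rcons mem_head orbT.
case: (split_ends hqL) => [[A [c [B [eL qc nA nB]]]]|[A [c [M [d [B [eL qc qd nA nB]]]]]]].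
  have qL z : z \in L -> e q z = (z == c).
    rewrite eL mem_cat inE => /or3P[zA|/eqP->|zB].
    - rewrite (negbTE (hasPn nA z zA)); apply/esym/eqP => zc.
      by have := hasPn nA z zA; rewrite zc qc.
    - by rewrite qc eqxx.
    - rewrite (negbTE (hasPn nB z zB)); apply/esym/eqP => zc.
      by have := hasPn nB z zB; rewrite zc qc.
  have cL : c \in L by rewrite eL mem_cat mem_head orbT.
  have iK z : z \in c :: rcons B v ++ u :: A -> z \in u :: rcons L v.
    rewrite eL !(inE, mem_cat, mem_rcons).
    by case: (z == c); case: (z == v); case: (z == u); case: (z \in A); case: (z \in B).
  apply: no_pyramid; apply: (@pyramid_of _ _ e_sym e_irr c (rcons B v) (u :: A) (q :: Q)) => //.
  - apply: (ihole_catC e_sym (p := u :: A) (q := c :: rcons B v)).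
    by move: hK; rewrite eL rcons_cat.
  - by case: (B).
  - by left; case: (Q) Q0.
  move=> z w zQ /iK wK; split; first by rewrite dL.
  rewrite last_rcons /=; case: (inK w wK) => [->|->|wL].
  - by rewrite euQ // euv orFb eqxx andbT [u == c]eq_sym huL // andbF.
  - by rewrite evQ // evu eqxx andbT [v == c]eq_sym hvL // andbF.
  - by rewrite aQ // qL // huL // hvL // andbF orbF.
have [cL dL'] : c \in L /\ d \in L by rewrite eL !(inE, mem_cat) !eqxx !orbT.
have eL2 : L = rcons A c ++ M ++ d :: B by rewrite eL cat_rcons.
have uniqc : (c == d) = false.
  move: uniqL; rewrite eL2 cat_uniq => /and3P[_ /hasPn h _].
  apply/eqP => cd; have /h : d \in M ++ d :: B by rewrite mem_cat mem_head orbT.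
  by rewrite /= -cd mem_rcons mem_head.
have qL z : z \in rcons A c -> e q z = (z == c).
  rewrite mem_rcons inE => /predU1P[->|zA]; first by rewrite qc eqxx.
  rewrite (negbTE (hasPn nA z zA)); apply/esym/eqP => zc.
  by have := hasPn nA z zA; rewrite zc qc.
have qR z : z \in d :: B -> e q z = (z == d).
  rewrite inE => /predU1P[->|zB]; first by rewrite qd eqxx.
  rewrite (negbTE (hasPn nB z zB)); apply/esym/eqP => zc.
  by have := hasPn nB z zB; rewrite zc qd.
have qN z : z \in rcons A c ++ d :: B -> e q z = (z == c) || (z == d).
  have [->|zc] := eqVneq z c; first by rewrite qc.
  have [->|zd] := eqVneq z d; first by rewrite qd.
  by rewrite mem_cat => /orP[/qL->|/qR->]; apply: negbTE.
have [M0|M0] := eqVneq M [::].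
  rewrite {}M0 cat0s in eL2.
  apply: no_prism; apply: (@prism_of _ _ e_sym e_irr (u :: rcons A c) (d :: rcons B v) (q ::
      Q)) => //.
  - by rewrite cat_cons -rcons_cons -rcons_cat -eL2.
  - by rewrite /= size_rcons.
  - by rewrite /= size_rcons.
  - by case: (Q) Q0.
  rewrite cat_cons -rcons_cons -rcons_cat -eL2 => z w zQ wK; split; first by rewrite dL.
  rewrite /= !last_rcons; case: (inK w wK) => [->|->|wL].
  - by rewrite euQ // (eq_sym u c) (eq_sym u d) (huL c) // (huL d) // eqxx andbF andbT.
  - by rewrite evQ // (eq_sym v c) (eq_sym v d) (hvL c) // (hvL d) // eqxx orbT andbF andbT.
  - by rewrite aQ // qN -?eL2 // huL // hvL // andbF orbF.
have hD : ihole (M ++ rcons (d :: B) v ++ u :: rcons A c).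
  rewrite catA; apply: (ihole_catC e_sym (p := u :: rcons A c)).
  by rewrite cat_cons -rcons_cat -rcons_cat -eL2.
have pD : ipath (rcons (d :: B) v ++ u :: rcons A c).
  by case/ihole_cycP: hD.
have iD z : z \in rcons (d :: B) v ++ u :: rcons A c -> z \in u :: rcons L v.
  rewrite eL2 !(inE, mem_cat, mem_rcons).
  by case: (z == d); case: (z \in B); case: (z == v); case: (z == u); case: (z == c);
      case: (z \in A); rewrite ?orbT.
have qD z : z \in rcons (d :: B) v ++ u :: rcons A c -> e q z = (z == c) || (z == d).
  move=> zD; case: (inK z (iD z zD)) => [->|->|zL].
  - by rewrite e_sym (negbTE nuq) (eq_sym u c) (eq_sym u d) !huL.
  - by rewrite e_sym (negbTE nvq) (eq_sym v c) (eq_sym v d) !hvL.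
  - apply: qN; move: zD; rewrite !(mem_cat, inE, mem_rcons) huL // hvL //=.
    by rewrite orbC.
apply: no_pyramid; apply: (@pyramid_of _ _ e_sym e_irr q (rcons (d :: B) v) (u :: rcons A c)
    Q) => //.
- apply: (@ihole_arc _ e e_sym [:: q] _) => //.
  + by rewrite size_cat /= !size_rcons; clear; lia.
  + move=> z w zD; rewrite inE => /eqP->; split.
      by rewrite eq_sym dL ?mem_head ?iD.
    rewrite eqxx !andbT e_sym qD // last_cat /= last_rcons orbC.
    by case: (B).
(* Here [q] is the apex, so [Q] may be a single vertex; the other two paths each contain an end of
   the edge [v u] and a neighbour of [q]. *)
- by right; rewrite lt0n size_eq0 Q0 /= !size_rcons.
move=> z w zQ; have zqQ : z \in q :: Q by rewrite inE zQ orbT.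
have zq : z != q by apply: contraNneq qnQ => <-.
have lz : last z Q = last q Q by case: (Q) Q0.
rewrite last_rcons inE => /predU1P[->|wD].
  rewrite eqxx andbT e_sym eqQ // ![q == _](dL q) ?mem_head // andbF orbF; split=> //.
have wK := iD w wD; split; first by rewrite dL.
have -> : (w == q) = false by rewrite eq_sym dL ?mem_head.
rewrite andbF /= lz; case: (inK w wK) => [->|->|wL].
- by rewrite euQ // euv eqxx andbT.
- by rewrite evQ // eqxx andbT.
- by rewrite aQ // (negbTE zq) huL // hvL // andbF.
Qed.

(** This is a theta with ends [c] and [d] whose third path has the single interior vertex [v]. *)
Lemma two_attachments K c d v : ihole K -> c \in K -> d \in K -> c != d -> ~~ e c d ->
  v \notin K -> {in K, forall z, e v z = (z == c) || (z == d)} -> False.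
Proof.
move=> hK cK dK ncd necd vK evK.
have [L hL iL] := ihole_mem e_sym hK cK.
have : d \in L by move: dK; rewrite -iL inE eq_sym (negbTE ncd).
move=> dL; case/splitPr: dL hL iL => A B hL iL.
have [_ _ _ ex] := hL.
have := ex d; rewrite mem_cat mem_head orbT (negbTE necd) => /(_ isT) hh.
apply: no_theta; apply: (@theta_of _ _ e_sym e_irr c d A B [:: v]) => //.
- by case: (A) hh => //=; rewrite eqxx.
- by case: (B) hh => //=; rewrite last_cat /= eqxx orbT.
move=> z w; rewrite inE => /eqP-> wK; rewrite eqxx /= evK -?iL //; split=> //.
by apply: contraNneq vK => ->; rewrite -iL.
Qed.

Lemma count_le2 (f : pred T) A : uniq A -> has f A -> count f A < 3 ->
  (exists2 c, c \in A /\ f c & {in A, forall z, f z = (z == c)}) \/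
  (exists c d, [/\ c \in A, d \in A, c != d, f c /\ f d &
     {in A, forall z, f z = (z == c) || (z == d)}]).
Proof.
move=> uA; rewrite has_count -size_filter => c0 c3.
have fE z : z \in A -> f z = (z \in filter f A) by rewrite mem_filter => ->; rewrite andbT.
have sub z : z \in filter f A -> z \in A /\ f z by rewrite mem_filter => /andP[].
have := filter_uniq f uA.
case: (filter f A) c0 c3 fE sub => // c [|d [|//]] _ _ fE sub.
  move=> _; left; exists c; first by apply: sub; rewrite mem_head.
  by move=> z zA; rewrite fE // inE.
rewrite /= inE andbT => ncd; right; exists c, d.
have [cA fc] := sub c (mem_head _ _).
have [|dA fd] := sub d; first by rewrite inE mem_head orbT.
by split=> // z zA; rewrite fE // !inE.
Qed.

(* With at most two neighbours, [x] attaches to the hole at a vertex or at an edge,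
   so that the edge [w x] is a path as in [attach_vertex] or [attach_edge]. *)
Lemma adjacent_attachments_aux A B x w c d : ihole (A ++ B) ->
  x \notin A ++ B -> w \notin A ++ B -> e x w -> x != w ->
  ~~ has (e x) B -> ~~ has (e w) A -> c \in A -> d \in B ->
  e x c -> e w d -> ~~ e c d -> 3 <= count (e x) A.
Proof.
move=> hK xK wK exw nxw nB nA cA dB xc wd ncd; rewrite leqNgt; apply/negP => c3.
have uK := ihole_uniq hK.
have uA : uniq A by move: uK; rewrite cat_uniq => /andP[].
have hxA : has (e x) A by apply/hasP; exists c.
have iA z : z \in A -> z \in A ++ B by rewrite mem_cat => ->.
have iB z : z \in B -> z \in A ++ B by rewrite mem_cat orbC => ->.
have cd : c != d.
  by apply/eqP => cd; have := uniq_catP uK cA; rewrite cd dB.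
have wx : path e w [:: x] by rewrite /= e_sym exw.
case: (count_le2 uA hxA c3) => [[c' _ xE]|[c1 [c2 [c1A c2A n12 [x1 x2] xE]]]].
  have {c' xE} xE : {in A ++ B, forall z, e x z = (z == c)}.
    have cc : c = c' by apply/eqP; rewrite -xE.
    move=> z; rewrite mem_cat => /orP[zA|zB]; first by rewrite cc xE.
    rewrite (negbTE (hasPn nB z zB)); apply/esym/eqP => zc.
    by have := hasPn nB z zB; rewrite zc xc.
  have [L hL iL] := ihole_mem e_sym hK (iA c cA).
  have cL : c \notin L by case: hL.
  apply: (attach_vertex hL wx).
  - by move=> z; rewrite iL !inE => /orP[] /eqP->.
  - by rewrite e_sym (hasPn nA).
  - by rewrite /= e_sym xc.
  - apply/hasP; exists d; last by rewrite wd.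
    by have := iB d dB; rewrite -iL inE eq_sym (negbTE cd).
  - move=> z; rewrite inE => /eqP->; apply/hasPn => z' z'L.
    rewrite xE; last by rewrite -iL inE z'L orbT.
    by apply: contraNneq cL => <-.
have {}xE : {in A ++ B, forall z, e x z = (z == c1) || (z == c2)}.
  move=> z; rewrite mem_cat => /orP[zA|zB]; first by rewrite xE.
  have [z1 z2] : z != c1 /\ z != c2.
    by split; apply: contraTneq zB => ->; apply: uniq_catP uK _.
  by rewrite (negbTE (hasPn nB z zB)) (negbTE z1) (negbTE z2).
have [e12|ne12] := boolP (e c1 c2); last first.
  exact: (two_attachments hK (iA _ c1A) (iA _ c2A) n12 ne12 xK xE).
have [L hL iL] := ihole_edge e_sym e_irr hK (iA _ c1A) (iA _ c2A) e12.
have uL := ihole_uniq hL.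
apply: (attach_edge hL wx).
- by move=> z; rewrite iL !inE => /orP[] /eqP->.
- by rewrite e_sym (hasPn nA).
- by rewrite e_sym (hasPn nA).
- apply/hasP; exists d => //; have := iB d dB; rewrite -iL inE mem_rcons inE.
  have dA : d \notin A by apply: contraL dB => /(uniq_catP uK).
  by case/or3P=> // /eqP dd; rewrite dd ?c1A ?c2A in dA.
- by rewrite /= e_sym x1.
- move=> z; rewrite inE => /eqP->; rewrite x1 x2; split=> //.
  apply/hasPn => z' z'L; rewrite xE; last by rewrite -iL inE mem_rcons inE z'L !orbT.
  move: uL; rewrite /= mem_rcons rcons_uniq inE negb_or => /and3P[/andP[_ h1] h2 _].
  by apply/norP; split; apply: contraTneq z'L => ->.
Qed.

(** If some pair [c], [d] were nonadjacent, the preceding lemma, applied to [x] and then with the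
    roles of [x] and [w] exchanged, would give each of them three neighbours on its own arc, hence a
    turtle. *)
Lemma adjacent_attachments A B x w c d : ihole (A ++ B) ->
  x \notin A ++ B -> w \notin A ++ B -> e x w ->
  ~~ has (e x) B -> ~~ has (e w) A -> c \in A -> d \in B ->
  e x c -> e w d -> e c d.
Proof.
move=> hK xK wK exw nB nA cA dB xc wd; apply/negPn/negP => ncd.
have nxw : x != w by apply: contraTneq exw => ->; rewrite e_irr.
have hK' := ihole_catC e_sym hK.
have mE z : (z \in B ++ A) = (z \in A ++ B) by rewrite !mem_cat orbC.
apply: no_turtle; apply: (@turtle_of _ _ e_sym e_irr A B x w) => //.
  exact: (@adjacent_attachments_aux A B x w c d).
apply: (@adjacent_attachments_aux B A w x d c); rewrite ?mE //; first by rewrite e_sym.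
  by rewrite eq_sym.
by rewrite e_sym.
Qed.

End Attach.

(** * Paths crossing a sector *)

Section Crossing.
Variables (T : finType) (e : rel T).
Hypotheses (e_sym : symmetric e) (e_irr : irreflexive e).
Hypotheses (no_theta : ~ theta e) (no_pyramid : ~ pyramid e).
Hypotheses (no_prism : ~ prism e) (no_turtle : ~ turtle e).
Implicit Types (A B C K L P Q I J : seq T) (q u v x y z h t : T).

Local Notation ipath := (ipath e).
Local Notation ihole := (ihole e).

Lemma rcons_split (A C X : seq T) b z : rcons X z = A ++ b :: C ->
  [/\ C = [::], X = A & z = b] \/ exists2 C', C = rcons C' z & X = A ++ b :: C'.
Proof.
case/lastP: C => [|C c]; first by rewrite cats1 => /rcons_inj[-> ->]; left.
by rewrite -rcons_cons -rcons_cat => /rcons_inj[-> ->]; right; exists C.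
Qed.

Lemma ipath_path x P : ipath (x :: P) -> path e x P.
Proof.
elim: P x => // y P IH x /ipath_cons[_ ex /= hP].
by rewrite ex ?mem_head //= eqxx IH.
Qed.

Lemma ipath_walk (f : pred T) P q : ipath P -> q \in P -> has f P ->
  exists p, [/\ path e q p, {subset p <= P} & has f (q :: p)].
Proof.
move=> hP /splitPr eP; case: eP hP => A B hP; rewrite has_cat => /orP[fA|fB].
  exists (rev A); split=> [|z|]; last by rewrite /= has_rev fA orbT.
    apply: ipath_path; rewrite -rev_rcons; apply: (ipath_rev e_sym).
    by move: hP; rewrite -cat_rcons => /ipath_cat[].
  by rewrite mem_rev mem_cat => ->.
exists B; split=> [|z zB|//]; first by apply: ipath_path; case/ipath_cat: hP.
by rewrite mem_cat inE zB !orbT.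
Qed.

(** The path [c K b] and [Q] close to a hole off which [x] and [w] lie. Since [x] sees nothing in
    [K] and [w] nothing in [Q], the hole splits into an arc for each, and every neighbour of [x]
    must be adjacent to every neighbour of [w]. *)
Lemma detour_hole c K b Q x w v d : ipath (c :: rcons K b) -> ipath Q -> Q != [::] ->
  2 <= size K + size Q ->
  (forall z u, z \in Q -> u \in c :: rcons K b -> (z != u) /\
     e z u = (z == head z Q) && (u == c) || (z == last z Q) && (u == b)) ->
  x \notin c :: rcons K b -> x \notin Q -> w \notin c :: rcons K b -> w \notin Q ->
  e x w -> ~~ has (e w) Q -> ~~ has (e x) K ->
  (e x c -> ~~ e w c) -> (e x b -> ~~ e w b) ->
  v \in Q ++ c :: rcons K b -> d \in c :: rcons K b -> e x v -> e w d -> e v d.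
Proof.
move=> hK hQ Q0 sz att xK xQ wK wQ exw nwQ nxK xc xb vin din exv ewd.
have hM : ihole ((c :: rcons K b) ++ rev Q).
  apply: (ihole_arc e_sym); rewrite ?rev_nil ?(ipath_rev e_sym) //.
    by rewrite size_rev /= size_rcons; move: sz; clear; lia.
  move=> z u; rewrite mem_rev => zQ uK; have [h1 h2] := att z u zQ uK.
  by split=> //; rewrite h2 head_rev last_rev /= last_rcons orbC.
(* Each of the ends [c] and [b] goes to the arc of [x] if [x] sees it and to the arc of [w]
   otherwise; no end is seen by both. *)
pose C1 := if e x c then [:: c] else [::].
pose D1 := if e x c then [::] else [:: c].
pose C2 := if e x b then [:: b] else [::].
pose D2 := if e x b then [::] else [:: b].
have eM : c :: rcons K b = C1 ++ (D1 ++ K ++ D2) ++ C2.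
  by rewrite /C1 /C2 /D1 /D2 -cats1; case: (e x c); case: (e x b); rewrite /= ?cats0 -?catA.
have inM z : (z \in (C2 ++ rev Q ++ C1) ++ (D1 ++ K ++ D2)) =
    (z \in c :: rcons K b) || (z \in Q).
  rewrite eM !mem_cat mem_rev.
  by case: (z \in C2); case: (z \in C1); case: (z \in Q); case: (z \in D1); case: (z \in K);
      case: (z \in D2).
have hM' : ihole ((C2 ++ rev Q ++ C1) ++ (D1 ++ K ++ D2)).
  have h : ihole (C1 ++ ((D1 ++ K ++ D2) ++ C2 ++ rev Q)).
    by move: hM; rewrite eM -!catA.
  apply: (ihole_catC e_sym); move: (ihole_catC e_sym h).
  by rewrite -!catA.
have nB : ~~ has (e x) (D1 ++ K ++ D2).
  rewrite !has_cat (negbTE nxK) /D1 /D2.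
  by case: ifP => h1; case: ifP => h2; rewrite /= ?h1 ?h2.
have nA : ~~ has (e w) (C2 ++ rev Q ++ C1).
  rewrite !has_cat has_rev (negbTE nwQ) /C1 /C2.
  by case: (boolP (e x c)) => [/xc/negbTE h1|_];
     case: (boolP (e x b)) => [/xb/negbTE h2|_]; rewrite /= ?h1 ?h2.
apply: (adjacent_attachments e_sym e_irr no_theta no_pyramid no_prism no_turtle hM' _ _ exw
    nB nA) => //.
- by rewrite inM negb_or xK.
- by rewrite inM negb_or wK.
- have : v \in (C2 ++ rev Q ++ C1) ++ (D1 ++ K ++ D2) by rewrite inM orbC -mem_cat.
  by rewrite mem_cat => /orP[//|vB]; have := hasPn nB v vB; rewrite exv.
- have : d \in (C2 ++ rev Q ++ C1) ++ (D1 ++ K ++ D2) by rewrite inM din.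
  by rewrite mem_cat => /orP[dA|//]; have := hasPn nA d dA; rewrite ewd.
Qed.

Section Center.
Variable w : T.

(* [v] has a neighbour on the hole outside the extended neighbourhood of [x I y]. *)
Definition far y' J x' v :=
  [|| has (e v) J, e v y' && ~~ e w y' | e v x' && ~~ e w x'].

(* [cfg_PI] and [cfg_far] are what the minimality of the path [p1 :: P] provides. *)
Record config x I y y' J x' p1 P : Prop := Config {
  cfg_hole : ihole ((x :: rcons I y) ++ (y' :: rcons J x'));
  cfg_I0 : I != [::];
  cfg_wK : w \notin (x :: rcons I y) ++ (y' :: rcons J x');
  cfg_wx : e w x;
  cfg_wy : e w y;
  cfg_wI : ~~ has (e w) I;
  cfg_P : ipath (p1 :: P);
  cfg_wP : ~~ has (e w) (p1 :: P);
  cfg_PK : {in p1 :: P, forall v, v \notin (x :: rcons I y) ++ (y' :: rcons J x')};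
  cfg_p1 : has (e p1) I;
  cfg_PI : {in P, forall v, ~~ has (e v) I};
  cfg_far : {in belast p1 P, forall v, ~~ far y' J x' v};
  cfg_pk : far y' J x' (last p1 P) }.

Lemma config_rev x I y y' J x' p1 P : config x I y y' J x' p1 P ->
  config y (rev I) x x' (rev J) y' p1 P.
Proof.
case=> h1 h2 h3 h4 h5 h6 h7 h8 h9 h10 h11 h12 h13.
have r u v X : u :: rcons (rev X) v = rev (v :: rcons X u).
  by rewrite rev_cons rev_rcons.
have mE z : (z \in (y :: rcons (rev I) x) ++ x' :: rcons (rev J) y') =
    (z \in (x :: rcons I y) ++ y' :: rcons J x').
  by rewrite !r !mem_cat !mem_rev.
have fE v : far x' (rev J) y' v = far y' J x' v by rewrite /far has_rev [X in _ || X]orbC.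
split=> //; rewrite ?rev_nil ?has_rev ?mE ?fE //.
- by rewrite !r; apply: (ihole_catC e_sym); rewrite -rev_cat; apply: (ihole_rev e_sym).
- by move=> v vP; rewrite mE; apply: h9.
- by move=> v vP; rewrite has_rev; apply: h11.
- by move=> v vP; rewrite fE; apply: h12.
Qed.

(** When [J] is the interior of another sector of [w], the path read backwards crosses from [J] to
    [I]. As [w] sees [x] and [y], [far] for the exchanged frame just means having a neighbour in
    [I]. *)
Lemma config_rot x I y y' J x' p1 P : config x I y y' J x' p1 P ->
  e w y' -> e w x' -> ~~ has (e w) J -> has (e (last p1 P)) J ->
  config y' J x' x I y (last p1 P) (rev (belast p1 P)).
Proof.
case=> h1 h2 h3 h4 h5 h6 h7 h8 h9 h10 h11 h12 h13 wy' wx' wJ pJ.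
have rP : last p1 P :: rev (belast p1 P) = rev (p1 :: P) by rewrite [in RHS]lastI rev_rcons.
have mE z : (z \in (y' :: rcons J x') ++ x :: rcons I y) =
    (z \in (x :: rcons I y) ++ y' :: rcons J x').
  by rewrite !mem_cat orbC.
have lP : last (last p1 P) (rev (belast p1 P)) = p1.
  by rewrite -[LHS]/(last p1 (last p1 P :: _)) rP last_rev.
have bP : belast (last p1 P) (rev (belast p1 P)) = rev P.
  have := lastI (last p1 P) (rev (belast p1 P)).
  by rewrite rP lP rev_cons => /rcons_inj[->].
split=> //; rewrite ?rP ?has_rev ?mE //.
- exact: (ihole_catC e_sym).
- by case: (J) pJ.
- exact: (ipath_rev e_sym).
- by move=> v; rewrite mem_rev mE; apply: h9.
- by move=> v; rewrite mem_rev => /h12; rewrite /far negb_or => /andP[].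
- rewrite bP => v; rewrite mem_rev => /h11 h; rewrite /far (negbTE h) h4 h5.
  by rewrite !andbF.
- by rewrite lP /far h10.
Qed.

(** * Adjacencies and obstructions inside a fixed configuration *)

Section Facts.
Variables (x y y' x' p1 : T) (I J P : seq T).
Hypothesis cfg : config x I y y' J x' p1 P.

Lemma cfg_cross u v : u \in x :: rcons I y -> v \in y' :: rcons J x' ->
  (u != v) /\ e u v = (u == y) && (v == y') || (u == x) && (v == x').
Proof.
have [_ _ _ l] := ihole_cycP (isT : x :: rcons I y != [::]) (isT : y' :: rcons J x' != [::])
    (cfg_hole cfg).
by move=> uA vB; have := l u v uA vB; rewrite /= !last_rcons.
Qed.

Lemma cfg_ipath : ipath (x :: rcons I y) /\ ipath (y' :: rcons J x').
Proof. by have [_ ? ? _] := @ihole_cycP _ e (x :: _) (y' :: _) isT isT (cfg_hole cfg). Qed.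

Lemma cfg_ne : [/\ x \notin I, y \notin I, x != y, uniq I & uniq J] /\
  [/\ y' \notin J, x' \notin J & y' != x'].
Proof.
have [/ipath_uniq u1 /ipath_uniq u2] := cfg_ipath.
move: u1 u2; rewrite /= !mem_rcons !inE !negb_or !rcons_uniq.
by move=> /andP[/andP[-> ->] /andP[-> ->]] /andP[/andP[-> ->] /andP[-> ->]].
Qed.

Lemma cfg_xA v : v \in rcons I y -> e x v = (v == head v I).
Proof.
have [/ipath_cons[_ h _] _] := cfg_ipath => vA; rewrite h //.
by case: (I) (cfg_I0 cfg).
Qed.

Lemma cfg_yA v : v \in x :: I -> e y v = (v == last v I).
Proof.
have [h _] := cfg_ipath; have := ipath_rev e_sym h.
rewrite rev_cons rev_rcons rcons_cons => /ipath_cons[_ {}h _] vA; rewrite h.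
  by case/lastP: (I) (cfg_I0 cfg) => // X a _; rewrite rev_rcons last_rcons.
by rewrite mem_rcons inE mem_rev; move: vA; rewrite inE.
Qed.

Lemma cfg_xy : e x y = false.
Proof.
rewrite cfg_xA ?mem_rcons ?mem_head //; have [[_ yI _ _ _] _] := cfg_ne.
by apply/eqP; case: (I) (cfg_I0 cfg) yI => // a I' _ + ya; rewrite inE {1}ya eqxx.
Qed.

Lemma cfg_small_hole : ihole (w :: x :: rcons I y).
Proof.
have [h _] := cfg_ipath; have [[xI yI nxy _ _] _] := cfg_ne.
split=> //.
- by case: (I) (cfg_I0 cfg) => //= a I' _; rewrite size_rcons.
- by apply: contra (cfg_wK cfg); rewrite mem_cat => ->.
move=> v; rewrite inE /= last_rcons mem_rcons inE => /or3P[/eqP->|/eqP->|vI].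
- by rewrite (cfg_wx cfg) eqxx.
- by rewrite (cfg_wy cfg) eqxx orbT.
rewrite (negbTE (hasPn (cfg_wI cfg) v vI)); apply/esym/norP; split.
  by apply: contraTneq vI => ->.
by apply: contraTneq vI => ->.
Qed.

(** If [w] were [p1], it would have a neighbour in [I]; if it came later, its predecessor on the
    path would be a neighbour of [w]. *)
Lemma cfg_wnP : w \notin p1 :: P.
Proof.
apply/negP; rewrite inE => /predU1P[wp|wP].
  by have := cfg_wI cfg; rewrite wp (cfg_p1 cfg).
have := cfg_P cfg; have := cfg_wP cfg.
case/splitPr: wP => A B; rewrite -cat_cons => nw /ipath_cat[_ _ l].
have [_] := l (last p1 A) w (mem_last _ _) (mem_head _ _).
rewrite /= !eqxx e_sym; apply/negP; apply: (hasPn nw).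
by rewrite mem_cat mem_last.
Qed.

(* Otherwise [w] has exactly two neighbours, [x] and [y]. *)
Lemma center_meets_other_side : has (e w) (y' :: rcons J x').
Proof.
apply/negPn/negP => nB.
have [[_ _ nxy _ _] _] := cfg_ne.
have xK : x \in (x :: rcons I y) ++ (y' :: rcons J x') by rewrite mem_cat mem_head.
have yK : y \in (x :: rcons I y) ++ (y' :: rcons J x').
  by rewrite mem_cat inE mem_rcons mem_head orbT.
apply: (two_attachments e_sym e_irr no_theta (cfg_hole cfg) xK yK nxy _ (cfg_wK cfg)).
  by rewrite cfg_xy.
move=> z; rewrite mem_cat => /orP[zA|zB].
  have [_ _ _ ew] := cfg_small_hole.
  by rewrite ew //= last_rcons.
rewrite (negbTE (hasPn nB z zB)); apply/esym/norP; split.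
- by rewrite eq_sym; have [] := cfg_cross (mem_head _ _) zB.
- by rewrite eq_sym; have [] := cfg_cross (_ : y \in _) zB;
    rewrite ?inE ?mem_rcons ?mem_head ?orbT.
Qed.

Lemma cfg_memI v : v \in I -> v \in x :: rcons I y.
Proof. by rewrite inE mem_rcons inE => ->; rewrite !orbT. Qed.

Lemma cfg_memJ v : v \in J -> v \in y' :: rcons J x'.
Proof. by rewrite inE mem_rcons inE => ->; rewrite !orbT. Qed.

Lemma cfg_memx : x \in x :: rcons I y. Proof. exact: mem_head. Qed.

Lemma cfg_memy : y \in x :: rcons I y.
Proof. by rewrite inE mem_rcons mem_head orbT. Qed.

Lemma cfg_memy' : y' \in y' :: rcons J x'. Proof. exact: mem_head. Qed.

Lemma cfg_memx' : x' \in y' :: rcons J x'.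
Proof. by rewrite inE mem_rcons mem_head orbT. Qed.

Lemma cfg_xB v : v \in y' :: rcons J x' -> e x v = (v == x').
Proof.
move=> vB; have [_ ->] := cfg_cross cfg_memx vB.
by have [[_ _ /negbTE-> _ _] _] := cfg_ne; rewrite eqxx.
Qed.

Lemma cfg_yB v : v \in y' :: rcons J x' -> e y v = (v == y').
Proof.
move=> vB; have [_ ->] := cfg_cross cfg_memy vB.
by have [[_ _ nxy _ _] _] := cfg_ne; rewrite [y == x]eq_sym (negbTE nxy) eqxx orbF.
Qed.

Lemma cfg_IB u v : u \in I -> v \in y' :: rcons J x' -> e u v = false.
Proof.
move=> uI vB; have [_ ->] := cfg_cross (cfg_memI uI) vB.
have [[xI yI _ _ _] _] := cfg_ne; apply/norP; split.
  by rewrite negb_and; apply/orP; left; apply: contraNneq yI => <-.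
by rewrite negb_and; apply/orP; left; apply: contraNneq xI => <-.
Qed.

Lemma cfg_AJ u v : u \in x :: rcons I y -> v \in J -> e u v = false.
Proof.
move=> uA vJ; have [_ ->] := cfg_cross uA (cfg_memJ vJ).
have [_ [yJ xJ _]] := cfg_ne; apply/norP; split.
  by rewrite negb_and; apply/orP; right; apply: contraNneq yJ => <-.
by rewrite negb_and; apply/orP; right; apply: contraNneq xJ => <-.
Qed.

Lemma cfg_AB u v : u \in x :: rcons I y -> v \in y' :: rcons J x' -> (u == v) = false.
Proof. by move=> uA vB; have [/negbTE] := cfg_cross uA vB. Qed.

Lemma cfg_wA v : v \in x :: rcons I y -> (w == v) = false.
Proof.
by move=> vA; apply: contraNF (cfg_wK cfg) => /eqP->; rewrite mem_cat vA.
Qed.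

Lemma cfg_wB v : v \in y' :: rcons J x' -> (w == v) = false.
Proof.
by move=> vB; apply: contraNF (cfg_wK cfg) => /eqP->; rewrite mem_cat vB orbT.
Qed.

Lemma cfg_PA z v : z \in p1 :: P -> v \in x :: rcons I y -> (z == v) = false.
Proof.
by move=> zP vA; apply: contraNF (cfg_PK cfg zP) => /eqP->; rewrite mem_cat vA.
Qed.

Lemma cfg_PB z v : z \in p1 :: P -> v \in y' :: rcons J x' -> (z == v) = false.
Proof.
by move=> zP vA; apply: contraNF (cfg_PK cfg zP) => /eqP->; rewrite mem_cat vA orbT.
Qed.

Lemma cfg_wPe v : v \in p1 :: P -> e w v = false.
Proof. by move=> vP; apply/negbTE; apply: (hasPn (cfg_wP cfg)). Qed.

Lemma cfg_PIe z v : z \in P -> v \in I -> e z v = false.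
Proof. by move=> zP vI; apply/negbTE; apply: (hasPn (cfg_PI cfg zP)). Qed.

Lemma cfg_wIe v : v \in I -> e w v = false.
Proof. by move=> vP; apply/negbTE; apply: (hasPn (cfg_wI cfg)). Qed.

Lemma cfg_bJ z v : z \in belast p1 P -> v \in J -> e z v = false.
Proof.
by move=> /(cfg_far cfg)/norP[/hasPn h _] vJ; apply/negbTE/h.
Qed.

Lemma cfg_by' z : z \in belast p1 P -> e z y' -> e w y'.
Proof.
by move=> /(cfg_far cfg)/norP[_ /norP[+ _]]; rewrite negb_and negbK => /orP[/negbTE->|].
Qed.

Lemma cfg_bx' z : z \in belast p1 P -> e z x' -> e w x'.
Proof.
by move=> /(cfg_far cfg)/norP[_ /norP[_]]; rewrite negb_and negbK => /orP[/negbTE->|].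
Qed.

Lemma cfg_bP z : z \in belast p1 P -> z \in p1 :: P.
Proof. by rewrite lastI mem_rcons inE => ->; rewrite orbT. Qed.

Lemma cfg_split_last z : z \in p1 :: P -> z = last p1 P \/ z \in belast p1 P.
Proof. by rewrite lastI mem_rcons inE => /predU1P. Qed.

Lemma cfg_bne z : z \in belast p1 P -> (z == last p1 P) = false.
Proof.
have := ipath_uniq (cfg_P cfg); rewrite lastI rcons_uniq => /andP[h _] zb.
by apply: contraNF h => /eqP <-.
Qed.

Lemma cfg_P1 z : z \in P -> (z == p1) = false.
Proof.
have := ipath_uniq (cfg_P cfg) => /andP[h _] zb.
by apply: contraNF h => /eqP <-.
Qed.

(* Otherwise the neighbours of [w] are [x] and the edge [y y'], a pyramid with apex [x]. *)
Lemma center_meets_other_side_tail : has (e w) (rcons J x').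
Proof.
apply/negPn/negP => nB.
have wy' : e w y' by have := center_meets_other_side; rewrite /= (negbTE nB) orbF.
have rB : rev (y' :: rcons J x') = x' :: rev (y' :: J).
  by rewrite -rcons_cons rev_rcons.
have [_ hB] := cfg_ipath.
have wp : path e x' (rev (y' :: J)).
  by apply: ipath_path; rewrite -rB; apply: (ipath_rev e_sym).
have mB z : z \in x' :: rev (y' :: J) -> z \in y' :: rcons J x'.
  by rewrite -rB mem_rev.
have [[xI yI nxy _ _] [yJ xJ nxy']] := cfg_ne.
apply: (@attach_edge _ e e_sym e_irr no_pyramid no_prism w y (x :: I) x' (rev (y' :: J))) => //.
- exact: cfg_small_hole.
- move=> z /mB zB; rewrite inE eq_sym cfg_wB //=.
  by apply/negP => zA; have := cfg_AB zA zB; rewrite eqxx.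
- by apply: (hasPn nB); rewrite mem_rcons mem_head.
- by rewrite cfg_yB ?cfg_memx' // eq_sym.
- by rewrite /= e_sym cfg_xB ?cfg_memx' // eqxx.
- by rewrite has_rev /= wy'.
move=> z; rewrite mem_rev inE => /predU1P[->|zJ].
  rewrite !(e_sym y') wy' cfg_yB ?cfg_memy' // eqxx; split=> //=.
  rewrite e_sym cfg_xB ?cfg_memy' // (negbTE nxy') /=.
  by apply/hasPn => u uI; rewrite e_sym cfg_IB ?cfg_memy'.
rewrite (e_sym z y) (cfg_AJ cfg_memy zJ) (e_sym z w); split.
  by apply/negbTE; apply: (hasPn nB); rewrite mem_rcons inE zJ orbT.
apply/hasPn => u uI; rewrite e_sym cfg_AJ //.
by move: uI; rewrite !inE mem_rcons inE => /orP[->//|->]; rewrite !orbT.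
Qed.

(** A stretch of [P] between a neighbour of [y] and a neighbour of [x] sees neither [I] nor [w].
    With these two it gives three paths between [x] and [y], a theta. Shortening once in each
    direction leaves a single neighbour of [x] and of [y], at opposite ends. *)
Lemma not_both_touched : has (e x) P -> has (e y) P -> False.
Proof.
move=> /hasP[a aP xa] yP.
have hP : ipath P by have /ipath_cons[] := cfg_P cfg.
have [p [wp sp yp]] := ipath_walk hP aP yP.
have [Q [hQ sQ yQ]] := shortest_path wp yp.
have aQ : a \in rev (a :: Q) by rewrite mem_rev mem_head.
have xQ : has (e x) (rev (a :: Q)) by apply/hasP; exists a.
have eQ : rev (a :: Q) = last a Q :: rev (belast a Q).
  by rewrite lastI rev_rcons.
have wr : path e (last a Q) (rev (belast a Q)).
  by apply: ipath_path; rewrite -eQ; apply: (ipath_rev e_sym).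
rewrite eQ in xQ; have [R [hR sR xR]] := shortest_path wr xQ.
have sP z : z \in last a Q :: R -> z \in P.
  move/sR; rewrite -eQ mem_rev => /sQ; rewrite inE => /predU1P[->//|]; exact: sp.
have yR z : z \in last a Q :: R -> e y z = (z == last a Q).
  by move/sR; rewrite -eQ mem_rev; apply: yQ.
have hK : ihole (x :: I ++ y :: [:: w]).
  have := @ihole_catC _ e e_sym [:: w] (x :: rcons I y) cfg_small_hole.
  by rewrite /= cat_rcons.
have [[xI yI nxy _ _] _] := cfg_ne.
apply: no_theta; apply: (@theta_of _ _ e_sym e_irr x y I [:: w] (last a Q :: R)) => //.
  exact: cfg_I0 cfg.
move=> z v zR; have zP := sP z zR; have zP1 : z \in p1 :: P by rewrite inE zP orbT.
rewrite inE mem_cat !inE /= => /or4P[/eqP->|vI|/eqP->|/eqP->].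
- by rewrite cfg_PA ?cfg_memx // e_sym xR // eqxx (negbTE nxy) andbT andbF orbF.
- rewrite cfg_PA ?cfg_memI // cfg_PIe //; split=> //; apply/esym/norP.
  by split; rewrite negb_and; apply/orP; right; apply: contraTneq vI => ->.
- by rewrite cfg_PA ?cfg_memy // e_sym yR // eqxx (eq_sym y) (negbTE nxy) andbT andbF.
split; first by apply: contraNneq (cfg_wnP) => <-.
by rewrite e_sym cfg_wPe // (cfg_wA cfg_memx) (cfg_wA cfg_memy) !andbF.
Qed.

(* The detour leaves the sector at [c], follows [P], and avoids [x]. *)
Lemma detour_last c b A1 B1 J1 J2 : rcons I y = A1 ++ c :: B1 -> e p1 c -> ~~ has (e p1) B1 ->
  y' :: rcons J x' = J1 ++ b :: J2 -> e (last p1 P) b -> ~~ has (e (last p1 P)) J1 ->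
  ~~ has (e y) P -> ~~ e w y' \/ ~~ has (e y') (belast p1 P) ->
  (P != [::]) \/ J1 != [::] ->
  forall v d, e x v -> e w d -> v \in b :: p1 :: P -> d \in c :: B1 ++ J1 ++ [:: b] ->
  e v d.
Proof.
move=> eA p1c nB1 eB pkb nJ1 ny ny' sz v d xv wd vin din.
have [[xI yI nxy uI uJ] [yJ xJ nxy']] := cfg_ne.
have mA u : u \in c :: B1 -> u \in rcons I y by rewrite eA mem_cat => ->; rewrite orbT.
have mA' u : u \in c :: B1 -> u \in x :: rcons I y by move/mA; rewrite inE => ->; rewrite orbT.
have mB u : u \in rcons J1 b -> u \in y' :: rcons J x'.
  by rewrite eB -cat_rcons mem_cat => ->.
(* The vertex [x'] is seen by [x], so it may only be the end [b] of the detour. In that case the end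
   of [P] sees nothing else on the far arc, and [far] makes [x'] a nonneighbour of [w]. *)
have [xJ1 bx] : x' \notin J1 /\ ((b == x') ->
    [/\ ~~ e w x', ~~ e (last p1 P) y' & ~~ has (e (last p1 P)) J]).
  have uB := ipath_uniq (proj2 cfg_ipath).
  case: (@rcons_split J1 J2 (y' :: J) b x' eB) => [[_ eJ eb]|[J3 eJ2 eJ]].
    split; first by rewrite -eJ inE negb_or xJ eq_sym nxy'.
    move: nJ1; rewrite -eJ /= negb_or => /andP[n1 n2] _; split=> //.
    by have := cfg_pk cfg; rewrite /far (negbTE n2) (negbTE n1) /= => /andP[].
  have h z : z \in J1 ++ b :: J3 -> z != x'.
    rewrite -eJ; apply: contraTneq => ->.
    by rewrite inE negb_or xJ eq_sym nxy'.
  split; first by apply/negP => /= xJ1; have := h x'; rewrite mem_cat xJ1 eqxx => /(_ isT).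
  by have := h b; rewrite mem_cat mem_head orbT => /(_ isT)/negbTE->.
have hseg : ipath (c :: rcons (B1 ++ J1) b).
  have h := cfg_hole cfg; rewrite eA eB in h.
  apply: (@ihole_infix _ e e_sym (x :: A1) _ J2) => //.
  by move: h; rewrite /= cat_rcons -!catA.
have inseg u : (u \in c :: rcons (B1 ++ J1) b) = (u \in c :: B1) || (u \in rcons J1 b).
  by rewrite rcons_cat !inE mem_cat orbA.
apply: (@detour_hole c (B1 ++ J1) b (p1 :: P) x w v d) => //.
- exact: cfg_P cfg.
- rewrite size_cat /=; case: sz.
    by case: (P) => //= a P1 _; clear; lia.
  by case: (J1) => //= a J1' _; clear; lia.
- move=> z u zP; rewrite inseg => /orP[uA'|uB].
    rewrite cfg_PA ?mA' // /=; split=> //.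
    have -> : (u == b) = false.
      by apply: cfg_AB; [exact: mA' | apply: mB; rewrite mem_rcons mem_head].
    rewrite andbF orbF; move: zP; rewrite inE => /predU1P[->|zP].
      rewrite eqxx /=; move: uA'; rewrite inE => /predU1P[->|uB1]; first by rewrite p1c eqxx.
      rewrite (negbTE (hasPn nB1 u uB1)); apply/esym/eqP => uc.
      by have := hasPn nB1 u uB1; rewrite uc p1c.
    rewrite cfg_P1 //=; have := mA u uA'; rewrite mem_rcons inE => /predU1P[->|uI'].
      by rewrite e_sym; apply/negbTE/(hasPn ny).
    exact: cfg_PIe.
  rewrite cfg_PB ?mB //=; split=> //.
  have -> : (u == c) = false.
    by rewrite eq_sym; apply: cfg_AB; [apply: mA'; rewrite mem_head | exact: mB].
  rewrite andbF /=; case: (cfg_split_last zP) => [->|zb].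
    rewrite eqxx /=; move: uB; rewrite mem_rcons inE => /predU1P[->|uJ1];
        first by rewrite pkb eqxx.
    rewrite (negbTE (hasPn nJ1 u uJ1)); apply/esym/eqP => uc.
    by have := hasPn nJ1 u uJ1; rewrite uc pkb.
  rewrite cfg_bne //=; have := mB u uB; rewrite inE mem_rcons inE => /or3P[/eqP uy|/eqP ux|uJ'].
  - apply/negbTE/negP; rewrite uy => zy; have wy' := cfg_by' zb zy.
    case: ny' => [|/hasPn/(_ z zb)]; first by rewrite wy'.
    by rewrite e_sym zy.
  - have bx' : b == x'.
      by move: uB; rewrite mem_rcons inE ux (negbTE xJ1) orbF eq_sym.
    apply/negbTE/negP; rewrite ux => zx'; have := cfg_bx' zb zx'.
    by have [/negbTE-> _ _] := bx bx'.
  - exact: cfg_bJ.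
- rewrite inseg; apply/norP; split.
    apply/negP => /mA; rewrite mem_rcons inE (negbTE nxy) (negbTE xI) //.
  by apply/negP => /mB xB; have := cfg_AB cfg_memx xB; rewrite eqxx.
- by apply/negP => xP; have := cfg_PA xP cfg_memx; rewrite eqxx.
- rewrite inseg; apply/norP; split.
    by apply/negP => /mA' wA; have := cfg_wA wA; rewrite eqxx.
  by apply/negP => /mB wB; have := cfg_wB wB; rewrite eqxx.
- exact: cfg_wnP.
- by rewrite e_sym (cfg_wx cfg).
- exact: cfg_wP cfg.
- apply/hasPn => u; rewrite mem_cat => /orP[uB1|uJ1].
    have [hA _] := cfg_ipath; rewrite eA -cat_rcons -cat_cons in hA.
    case/ipath_cat: hA => _ _ /(_ x u (mem_head _ _) uB1)[_ ->].
    rewrite /= last_rcons; apply/nandP; left.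
    have : x \notin rcons I y by rewrite mem_rcons inE negb_or nxy.
    by apply: contraNneq => ->; apply: mA; rewrite mem_head.
  by rewrite cfg_xB ?mB ?mem_rcons ?inE ?uJ1 ?orbT //; apply: contraNneq xJ1 => <-.
- have := mA c (mem_head _ _); rewrite mem_rcons inE => /predU1P[->|cI].
    by rewrite cfg_xy.
  by rewrite cfg_wIe.
- rewrite cfg_xB ?mB ?mem_rcons ?mem_head // => ebx.
  by have [h _ _] := bx ebx; rewrite (eqP ebx).
- move: vin; rewrite !(inE, mem_cat, mem_rcons).
  by case/or3P=> ->; rewrite ?orbT.
- by move: din; rewrite rcons_cat -[rcons J1 b]cats1.
Qed.

(* The detour avoids the whole sector: it enters [P] from [y']. *)
Lemma detour_first Pa t Pb b J1 J2 : p1 :: P = Pa ++ t :: Pb -> e t y' -> ~~ has (e y') Pb ->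
  rcons J x' = J1 ++ b :: J2 -> e (last p1 P) b -> ~~ has (e (last p1 P)) J1 ->
  (b == x' -> ~~ e w x') -> (Pb != [::]) \/ J1 != [::] ->
  forall v d, e x v -> e w d -> v \in b :: t :: Pb -> d \in y' :: rcons J1 b ->
  e v d.
Proof.
move=> eP ty' nPb eB pkb nJ1 wb sz v d xv wd vin din.
have [[xI yI nxy uI uJ] [yJ xJ nxy']] := cfg_ne.
have mP z : z \in t :: Pb -> z \in p1 :: P by rewrite eP mem_cat => ->; rewrite orbT.
have lP : last p1 P = last t Pb.
  by rewrite -[LHS]/(last p1 (p1 :: P)) eP last_cat.
have mB u : u \in y' :: rcons J1 b -> u \in y' :: rcons J x'.
  by rewrite eB -cat_rcons !inE mem_cat => /orP[->//|->]; rewrite orbT.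
have [xJ1 bx] : x' \notin J1 /\ (x' \in rcons J1 b -> b = x').
  case: (rcons_split eB) => [[_ <- <-]|[J3 eJ2 eJ]]; first by [].
  have h z : z \in J1 ++ b :: J3 -> z != x'.
    by rewrite -eJ; apply: contraTneq => ->.
  split; first by apply/negP => /= xJ1; have := h x'; rewrite mem_cat xJ1 eqxx => /(_ isT).
  rewrite mem_rcons inE => /predU1P[->//|xJ1].
  by have := h x'; rewrite mem_cat xJ1 eqxx => /(_ isT).
have hseg : ipath (y' :: rcons J1 b).
  have [_] := cfg_ipath; rewrite eB -cat_rcons -cat_cons.
  by case/ipath_cat.
have hQ : ipath (t :: Pb) by have := cfg_P cfg; rewrite eP => /ipath_cat[].
have tPb z : z \in Pb -> (z == t) = false.
  by have /ipath_uniq/andP[h _] := hQ => zP; apply: contraNF h => /eqP<-.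
apply: (@detour_hole y' J1 b (t :: Pb) x w v d) => //.
- by case: sz; [case: (Pb) | case: (J1)] => //= ? ? _; clear; lia.
- move=> z u zQ uB; have zP := mP z zQ; rewrite cfg_PB ?mB //; split=> //.
  move: uB; rewrite inE => /predU1P[->|uB].
    rewrite /= eqxx andbT.
    have -> : (y' == b) = false.
      apply/eqP => yb; have : y' \notin rcons J x' by rewrite mem_rcons inE negb_or nxy'.
      by rewrite eB mem_cat yb mem_head orbT.
    rewrite andbF orbF; move: zQ; rewrite inE => /predU1P[->|zPb]; first by rewrite ty' eqxx.
    by rewrite tPb // e_sym; apply/negbTE/(hasPn nPb).
  have -> : (u == y') = false.
    apply/eqP => uy; have : y' \notin rcons J x' by rewrite mem_rcons inE negb_or nxy'.
    by rewrite eB -cat_rcons mem_cat -uy uB.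
  rewrite andbF /=; rewrite -lP; case: (cfg_split_last zP) => [->|zb].
    rewrite eqxx /=; move: uB; rewrite mem_rcons inE => /predU1P[->|uJ1];
        first by rewrite pkb eqxx.
    rewrite (negbTE (hasPn nJ1 u uJ1)); apply/esym/eqP => uc.
    by have := hasPn nJ1 u uJ1; rewrite uc pkb.
  rewrite cfg_bne //=.
  have : u \in rcons J x' by rewrite eB -cat_rcons mem_cat uB.
  rewrite mem_rcons inE => /predU1P[ux|uJ']; last exact: cfg_bJ.
  rewrite ux in uB *; apply/negbTE/negP => /(cfg_bx' zb).
  by apply/negP/wb/eqP/bx.
- by apply/negP => /mB xB; have := cfg_AB cfg_memx xB; rewrite eqxx.
- by apply/negP => /mP xP; have := cfg_PA xP cfg_memx; rewrite eqxx.
- by apply/negP => /mB xB; have := cfg_wB xB; rewrite eqxx.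
- by apply: contra cfg_wnP; apply: mP.
- by rewrite e_sym (cfg_wx cfg).
- by apply/hasPn => z /mP zP; rewrite cfg_wPe.
- apply/hasPn => u uJ1; rewrite cfg_xB; last by apply: mB; rewrite inE mem_rcons inE uJ1 !orbT.
  by apply: contraNneq xJ1 => <-.
- by rewrite cfg_xB ?cfg_memy' // (negbTE nxy').
- rewrite cfg_xB; last by apply: mB; rewrite inE mem_rcons mem_head !orbT.
  by move=> ebx; rewrite (eqP ebx); apply: wb.
- move: vin; rewrite !(inE, mem_cat, mem_rcons).
  by case/or3P=> ->; rewrite ?orbT.
Qed.

(** A detour past [y] and [y'] would force the neighbour [v0] of [x] on [P] to see [y]. It is
    blocked only if [w] sees [y'] and [y'] meets the path, and then [y'] itself serves as a starting
    point. *)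
Lemma touched_one_side : has (e x) P -> ~~ has (e y) P -> False.
Proof.
move=> /hasP[v0 v0P xv0] ny.
have [[xI yI nxy uI uJ] [yJ xJ nxy']] := cfg_ne.
have P0 : P != [::] by case: (P) v0P.
have lP : last p1 P \in P by case: (P) P0 => // a b _; rewrite /= mem_last.
have v0P1 : v0 \in p1 :: P by rewrite inE v0P orbT.
have [ty'|nty'] := boolP (e w y' && has (e y') (p1 :: P)); last first.
  have /split_last[A1 [c [B1 [eA p1c nB1]]]] : has (e p1) (rcons I y).
    by rewrite has_rcons (cfg_p1 cfg) orbT.
  have /split_first[J1 [b [J2 [eB pkb nJ1]]]] : has (e (last p1 P)) (y' :: rcons J x').
    have := cfg_pk cfg; rewrite /far /= has_rcons.
    by case/or3P=> [->|/andP[->]|/andP[->]]; rewrite ?orbT.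
  have : e v0 y.
    apply: (detour_last eA p1c nB1 eB pkb nJ1 ny) => //.
    - move: nty'; rewrite negb_and => /orP[->|h]; [by left|right].
      by apply/hasPn => z /cfg_bP zP; apply: (hasPn h).
    - by left.
    - exact: cfg_wy cfg.
    - by rewrite inE v0P1 orbT.
    - have : last x (rcons I y) = last c B1 by rewrite eA last_cat.
      rewrite last_rcons => ->; rewrite -cat_cons mem_cat mem_last //.
  by rewrite e_sym; apply/negP/(hasPn ny).
have [wy' hy'] := andP ty'.
(* On the hole [x I y w] the vertex [y'] sees exactly the edge [y w], and it reaches [x] through
   [P]: the pattern of a pyramid with apex [x]. *)
have [/hasP[t tP yt]|nP] := boolP (has (e y') P).
  have hP : ipath P by have /ipath_cons[] := cfg_P cfg.
  have xP : has (e x) P by apply/hasP; exists v0.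
  have [p [wp sp xp]] := ipath_walk hP tP xP.
  have hK : ihole (x :: rcons I y ++ [:: w]).
    exact: (@ihole_catC _ e e_sym [:: w] (x :: rcons I y) cfg_small_hole).
  apply: (@attach_vertex _ e e_sym e_irr no_theta no_pyramid x (rcons I y ++ [:: w]) y' (t ::
      p)) => //.
  - by rewrite /= yt.
  - move=> z zin; rewrite -cat_cons mem_cat mem_seq1 negb_or.
    move: zin; rewrite inE => /predU1P[->|zin].
      rewrite [y' == w]eq_sym cfg_wB ?cfg_memy' // andbT.
      by apply/negP => yA; have := cfg_AB yA cfg_memy'; rewrite eqxx.
    have zP : z \in p1 :: P.
      by rewrite inE; move: zin; rewrite inE => /predU1P[->|/sp->]; rewrite ?tP orbT.
    apply/andP; split; first by apply/negP => /(cfg_PA zP); rewrite eqxx.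
    by apply: contraNneq cfg_wnP => <-.
  - by rewrite cfg_xB ?cfg_memy'.
  - apply/hasP; exists y; first by rewrite mem_cat mem_rcons mem_head.
    by rewrite e_sym cfg_yB ?cfg_memy' // eqxx cfg_xy.
  - move=> z zin; have zP : z \in P by move: zin; rewrite inE => /predU1P[->|/sp].
    rewrite has_cat /= has_rcons !negb_or (cfg_PI cfg zP) e_sym (hasPn ny) //=.
    by rewrite e_sym cfg_wPe // inE zP orbT.
have p1y : e p1 y' by move: hy'; rewrite /= (negbTE nP) orbF e_sym.
have npk : e (last p1 P) y' = false by rewrite e_sym; apply/negbTE/(hasPn nP).
have far_pk : has (e (last p1 P)) J || e (last p1 P) x' && ~~ e w x'.
  by have := cfg_pk cfg; rewrite /far npk.
have /split_first[J1 [b [J2 [eB pkb nJ1]]]] : has (e (last p1 P)) (rcons J x').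
  by rewrite has_rcons; case/orP: far_pk => [->|/andP[->]]; rewrite ?orbT.
have : e v0 y'.
  apply: (@detour_first [::] p1 P b J1 J2 _ _ _ eB pkb nJ1 _ _ v0 y') => //.
  - move=> /eqP ebx; case/orP: far_pk => [/hasP[z zJ pz]|/andP[]//].
    case: (rcons_split eB) => [[_ eJ _]|[J3 _ eJ]].
      by have := hasPn nJ1 z; rewrite -eJ pz => /(_ zJ).
    by move: xJ; rewrite eJ mem_cat ebx mem_head orbT.
  - by left.
  - by rewrite inE v0P1 orbT.
  - exact: mem_head.
by rewrite e_sym; apply/negP/(hasPn nP).
Qed.

(** The path continues through [J] to a neighbour of [w], and on this route only [p1] sees the arc
    [x I y]. Its neighbour in [I] is a nonneighbour of [w], as [attach_vertex] at [w] requires. *)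
Lemma sector_attachment : ~~ has (e x) P -> ~~ has (e y) P ->
  has (e (last p1 P)) J -> has (e w) J -> False.
Proof.
move=> nx ny /hasP[b bJ pb] wJ.
have hJ : ipath J.
  have [_] := cfg_ipath; rewrite -cats1 => /(@ipath_cat _ _ [:: y'] (J ++ _))[_ + _].
  by case/ipath_cat.
have [p [wp sp xp]] := ipath_walk hJ bJ wJ.
have sJ z : z \in b :: p -> z \in J by rewrite inE => /predU1P[->|/sp].
apply: (@attach_vertex _ e e_sym e_irr no_theta no_pyramid w (x :: rcons I y) p1 (P ++ b ::
    p)) => //.
- exact: cfg_small_hole.
- rewrite cat_path /= pb wp !andbT; apply: ipath_path; exact: cfg_P cfg.
- move=> z; rewrite -cat_cons mem_cat [z \in w :: _]inE negb_or => /orP[zP|/sJ zJ].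
    rewrite (contraNneq _ cfg_wnP) //=; last by move=> <-.
    by apply/negP => /(cfg_PA zP); rewrite eqxx.
  rewrite eq_sym cfg_wB ?cfg_memJ //=.
  by apply/negP => zA; have := cfg_AB zA (cfg_memJ zJ); rewrite eqxx.
- by rewrite cfg_wPe ?mem_head.
- by rewrite has_cat xp orbT.
- have /hasP[c cI pc] := cfg_p1 cfg.
  by apply/hasP; exists c; rewrite ?cfg_memI // pc cfg_wIe.
move=> z; rewrite mem_cat => /orP[zP|/sJ zJ].
  rewrite /= has_rcons (negbTE (cfg_PI cfg zP)) !(e_sym z).
  by rewrite (negbTE (hasPn nx z zP)) (negbTE (hasPn ny z zP)).
by apply/hasPn => u uA; rewrite e_sym cfg_AJ.
Qed.

(** * Paths ending at [x'] only, and paths joining two sectors *)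

Lemma cfg_xafter A1 c B1 u : rcons I y = A1 ++ c :: B1 -> u \in B1 -> e x u = false.
Proof.
move=> eA uB1; have [hA _] := cfg_ipath; rewrite eA -cat_rcons -cat_cons in hA.
have [[xI _ nxy _ _] _] := cfg_ne.
case/ipath_cat: hA => _ _ /(_ x u (mem_head _ _) uB1)[_ ->].
rewrite /= last_rcons; apply/negbTE/nandP; left.
have : x \notin rcons I y by rewrite mem_rcons inE negb_or nxy.
by apply: contraNneq => ->; rewrite eA mem_cat mem_head orbT.
Qed.

Lemma cfg_y'x' : J != [::] -> e y' x' = false.
Proof.
move=> J0; have [_ /ipath_cons[_ h _]] := cfg_ipath.
rewrite h ?mem_rcons ?mem_head //; have [_ [_ xJ _]] := cfg_ne.
apply/eqP; case: (J) J0 xJ => // a J' _ + /= xa; by rewrite xa mem_head.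
Qed.

(** A detour ending at [x'] keeps that neighbour of [x] on the hole. If [y'] misses the path, the
    detour past [y] would make [x'] adjacent to [y]. Otherwise the detour starts at [y'], and its
    constraints leave a single vertex seeing [y'] and [x']. *)
Lemma end_attachment : ~~ has (e x) P -> ~~ has (e y) P ->
  ~~ has (e (last p1 P)) J -> e (last p1 P) x' -> ~~ e w x' ->
  [/\ P = [::], ~~ e w y', e p1 y', ~~ e x p1 & {in J, forall z, e w z -> e x' z}].
Proof.
move=> nx ny npJ pkx' nwx'.
have [[xI yI nxy uI uJ] [yJ xJ nxy']] := cfg_ne.
have wJ : has (e w) J by have := center_meets_other_side_tail; rewrite has_rcons (negbTE nwx').
have J0 : J != [::] by case: (J) wJ.
have eB : y' :: rcons J x' = (y' :: J) ++ x' :: [::] by rewrite cats1.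
have pkP : last p1 P \in p1 :: P by rewrite mem_last.
have [hy'|ny'] := boolP (has (e y') (p1 :: P)); last first.
  have /split_last[A1 [c [B1 [eA p1c nB1]]]] : has (e p1) (rcons I y).
    by rewrite has_rcons (cfg_p1 cfg) orbT.
  have : e x' y.
    apply: (detour_last eA p1c nB1 eB pkx' _ ny) => //.
    - by rewrite /= negb_or npJ andbT e_sym (hasPn ny').
    - by right; apply/hasPn => z /cfg_bP zP; apply: (hasPn ny').
    - by right.
    - by rewrite cfg_xB ?cfg_memx'.
    - exact: cfg_wy cfg.
    - by rewrite mem_head.
    - have : last x (rcons I y) = last c B1 by rewrite eA last_cat.
      rewrite last_rcons => ->; rewrite -cat_cons mem_cat mem_last //.
  by rewrite e_sym cfg_yB ?cfg_memx' // eq_sym (negbTE nxy').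
have [Pa [t [Pb [eP ty' nPb]]]] := split_last hy'.
(* The hole runs along [y' J x'] and back through the path from its last neighbour of [y']. Testing
   [F] at [x'] and [y'] shows that [w] does not see [y']. *)
have F v d : e x v -> e w d -> v \in x' :: t :: Pb -> d \in y' :: rcons J x' -> e v d.
  apply: (@detour_first Pa t Pb x' J [::]) => //; first by rewrite e_sym.
    by rewrite cats1.
  by right.
have xx' : e x x' by rewrite cfg_xB ?cfg_memx'.
have nwy' : ~~ e w y'.
  apply/negP => wy'; have := F x' y' xx' wy' (mem_head _ _) cfg_memy'.
  by rewrite e_sym cfg_y'x'.
have P0 : P = [::].
  (* Since [w] does not see [y'], only the last vertex of the path may see [y']. If it differs from
     [p1], its neighbours on the whole hole are exactly [y'] and [x'], which gives a theta. *)
  apply/eqP/negPn/negP => P0.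
  have lP : last p1 P \in P by case: (P) P0 => // a b _; rewrite /= mem_last.
  have tP : t \in p1 :: P by rewrite eP mem_cat mem_head orbT.
  have pky' : e (last p1 P) y'.
    case: (cfg_split_last tP) => [<-|tb]; first by rewrite e_sym.
    by case/negP: nwy'; apply: (cfg_by' tb); rewrite e_sym.
  have y'K : y' \in (x :: rcons I y) ++ y' :: rcons J x' by rewrite mem_cat cfg_memy' orbT.
  have x'K : x' \in (x :: rcons I y) ++ y' :: rcons J x' by rewrite mem_cat cfg_memx' orbT.
  have ny'x' : ~~ e y' x' by rewrite cfg_y'x'.
  apply: (two_attachments e_sym e_irr no_theta (cfg_hole cfg) y'K x'K nxy' ny'x' (cfg_PK cfg
      pkP)).
  move=> z; rewrite mem_cat => /orP[zA|].
    rewrite (cfg_AB zA cfg_memy') (cfg_AB zA cfg_memx').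
    move: zA; rewrite inE mem_rcons inE => /or3P[/eqP->|/eqP->|zI].
    - by rewrite e_sym; apply/negbTE/(hasPn nx).
    - by rewrite e_sym; apply/negbTE/(hasPn ny).
    - exact: cfg_PIe.
  rewrite inE mem_rcons inE => /or3P[/eqP->|/eqP->|zJ]; rewrite ?pky' ?pkx' ?eqxx ?orbT //.
  rewrite (negbTE (hasPn npJ z zJ)); apply/esym/norP.
  by split; apply: contraTneq zJ => ->.
rewrite P0 /= in pkx' npJ *.
have [et ePb] : t = p1 /\ Pb = [::].
  by case: Pa eP => [|a [|? ?]]; rewrite P0 // => -[-> ->].
split=> //; first by rewrite e_sym -et.
  have /hasP[z zJ wz] := wJ.
  apply/negP => xp; have : e p1 z.
    by apply: F => //; [rewrite et !inE eqxx orbT | exact: cfg_memJ].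
  exact/negP/(hasPn npJ).
by move=> z zJ wz; apply: F => //; rewrite ?mem_head // cfg_memJ.
Qed.

(** Beyond the last neighbour [s] of [p1] on the sector, the stretch up to [y] closes with [y'] and
    [p1] to a hole. The vertex [w] sees [y] on it and meets it again through [x], at [s] or, by way
    of [x'], at [p1]. With a single vertex in [I] the configuration could be the cube. *)
Lemma both_ends_attachment : e p1 y' -> e p1 x' -> ~~ e x p1 -> ~~ e y p1 ->
  ~~ e w y' -> J != [::] -> 2 <= size I -> False.
Proof.
move=> py' px' nxp nyp nwy' J0 sI.
have [[xI yI nxy uI uJ] [yJ xJ nxy']] := cfg_ne.
have p1P : p1 \in p1 :: P by rewrite mem_head.
have /split_last[A1 [s [B1 [eA ps nB1]]]] : has (e p1) (rcons I y).
  by rewrite has_rcons (cfg_p1 cfg) orbT.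
have mA z : z \in s :: B1 -> z \in rcons I y by rewrite eA mem_cat => ->; rewrite orbT.
have mA' z : z \in s :: B1 -> z \in x :: rcons I y by move/mA; rewrite inE => ->; rewrite orbT.
have sy : s != y by apply: contraNneq nyp => <-; rewrite e_sym.
have sI' : s \in I.
  by have := mA s (mem_head _ _); rewrite mem_rcons inE (negbTE sy).
have yB1 : y \in B1.
  have : last x (rcons I y) = last s B1 by rewrite eA last_cat.
  rewrite last_rcons => yl; have := mem_last s B1; rewrite -yl inE.
  by rewrite eq_sym (negbTE sy).
have hs : ipath (s :: rcons B1 y').
  have h := cfg_hole cfg; rewrite eA in h.
  apply: (@ihole_infix _ e e_sym (x :: A1) _ (rcons J x')) => //.
  by move: h; rewrite /= cat_rcons -!catA.
have hK : ihole ((s :: rcons B1 y') ++ [:: p1]).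
  apply: (ihole_arc e_sym) => //.
    by case: (B1) yB1 => // b B' _; rewrite /= size_rcons addn1.
  move=> z v; rewrite inE => /eqP-> vin; rewrite /= last_rcons eqxx /=.
  move: vin; rewrite -rcons_cons mem_rcons inE => /predU1P[->|vA].
    by rewrite cfg_PB ?cfg_memy' // py' eqxx.
  rewrite cfg_PA ?mA' //; split=> //; rewrite (cfg_AB (mA' _ vA) cfg_memy') /=.
  move: vA; rewrite inE => /predU1P[->|vB]; first by rewrite ps eqxx.
  rewrite (negbTE (hasPn nB1 v vB)); apply/esym/eqP => vs.
  by have := hasPn nB1 v vB; rewrite vs ps.
have inK z : z \in (s :: rcons B1 y') ++ [:: p1] -> [\/ z \in s :: B1, z = y' | z = p1].
  rewrite mem_cat -rcons_cons mem_rcons mem_seq1 inE => /orP[/predU1P[->|zB]|/eqP->].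
  - exact: Or32.
  - exact: Or31.
  - exact: Or33.
have wK : w \notin (s :: rcons B1 y') ++ [:: p1].
  apply/negP => /inK[/mA' wA|wy'|wp].
  - by have := cfg_wA wA; rewrite eqxx.
  - by have := cfg_wB cfg_memy'; rewrite wy' eqxx.
  - by have := cfg_wnP; rewrite wp mem_head.
have xK : x \notin (s :: rcons B1 y') ++ [:: p1].
  apply/negP => /inK[/mA xA|xy'|xp].
  - by move: xA; rewrite mem_rcons inE (negbTE nxy) (negbTE xI).
  - by have := cfg_AB cfg_memx cfg_memy'; rewrite xy' eqxx.
  - by have := cfg_PA p1P cfg_memx; rewrite xp eqxx.
have nxB z : z \in B1 -> e x z = false by apply: cfg_xafter eA.
(* If [x] sees [s], then [s] is the first vertex of [I]. Having two vertices in [I] keeps [s] from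
   seeing [y], so [w] has on the hole a neighbour not adjacent to [s]. *)
have [xs|nxs] := boolP (e x s).
  have hK2 : ihole (s :: (rcons B1 y' ++ [:: p1])) by [].
  apply: (@attach_vertex _ e e_sym e_irr no_theta no_pyramid s _ w [:: x] hK2) => //.
  - by rewrite /= (cfg_wx cfg).
  - by move=> z; rewrite [z \in w :: _]inE mem_seq1 => /orP[] /eqP->.
  - by rewrite e_sym cfg_wIe.
  - by rewrite /= e_sym xs.
  - apply/hasP; exists y; first by rewrite mem_cat mem_rcons inE yB1 !orbT.
    rewrite (cfg_wy cfg) /= e_sym cfg_yA ?inE ?sI' ?orbT //.
    move: xs; rewrite cfg_xA ?mA ?mem_head // => /eqP sh.
    apply/eqP => sl; move: sI uI; case: (I) sh sl => // a [|a' I'] //= -> al _ /andP[].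
    by rewrite al mem_last.
  - move=> z; rewrite inE => /eqP->; rewrite has_cat has_rcons /= orbF !negb_or.
    rewrite cfg_xB ?cfg_memy' // nxy' nxp !andbT /=.
    by apply/hasPn => u uB; rewrite nxB.
apply: (@attach_vertex _ e e_sym e_irr no_theta no_pyramid p1 (s :: rcons B1 y') w [:: x;
    x']) => //.
- exact: (@ihole_catC _ e e_sym (s :: rcons B1 y') [:: p1] hK).
- by rewrite /= (cfg_wx cfg) cfg_xB ?cfg_memx' // eqxx.
- have eqm z : (z \in p1 :: s :: rcons B1 y') = (z \in (s :: rcons B1 y') ++ [:: p1]).
    by rewrite mem_cat mem_seq1 inE orbC.
  move=> z; rewrite eqm [z \in w :: _]inE [z \in [:: x; _]]inE mem_seq1.
  case/or3P=> /eqP-> //.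
  apply/negP => /inK[/mA' xA|xy'|xp].
  - by have := cfg_AB xA cfg_memx'; rewrite eqxx.
  - by move: nxy'; rewrite xy' eqxx.
  - by have := cfg_PB p1P cfg_memx'; rewrite xp eqxx.
- by rewrite e_sym cfg_wPe.
- by rewrite /= px' orbT.
- apply/hasP; exists y; first by rewrite inE mem_rcons inE yB1 !orbT.
  by rewrite (cfg_wy cfg) e_sym nyp.
move=> z; rewrite !inE => /orP[] /eqP->; apply/hasPn => u; rewrite -rcons_cons mem_rcons inE.
  case/predU1P => [->|]; first by rewrite cfg_xB ?cfg_memy'.
  by rewrite inE => /predU1P[->//|/nxB->].
case/predU1P => [->|uA]; first by rewrite e_sym cfg_y'x'.
rewrite e_sym; have := mA u uA; rewrite mem_rcons inE => /predU1P[->|uI'].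
  by rewrite cfg_yB ?cfg_memx' // eq_sym.
by rewrite cfg_IB ?cfg_memx'.
Qed.

(** The path is closed to a hole through the edge [x' x]: from its last neighbour [t] on [J x'] to
    [x'], and from [x] to its first neighbour [s] on the sector. The rest [E] of the sector leads to
    [y] and then to [w], which sees both ends of that edge, so [attach_edge] applies. *)
Lemma hub_one_end : ~~ has (e x) P -> ~~ has (e y) P ->
  ~~ has (e x') (belast p1 P) -> e w x' -> ~~ has (e w) J ->
  has (e (last p1 P)) J -> ~~ e x p1 -> False.
Proof.
move=> nx ny nx' wx' nwJ pJ nxp.
have [[xI yI nxy uI uJ] [yJ xJ nxy']] := cfg_ne.
have p1P : p1 \in p1 :: P by rewrite mem_head.
have /split_first[A1 [s [E [eA ps nA1]]]] : has (e p1) (rcons I y).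
  by rewrite has_rcons (cfg_p1 cfg) orbT.
have sy : s != y.
  apply/eqP => sy; have /hasP[c cI pc] := cfg_p1 cfg.
  case: (rcons_split eA) => [[_ eI _]|[E' _ eI]].
    by have := hasPn nA1 c; rewrite -eI pc => /(_ cI).
  by move: yI; rewrite eI mem_cat -sy mem_head orbT.
have [E' eE eI] : exists2 E', E = rcons E' y & I = A1 ++ s :: E'.
  by case: (rcons_split eA) => [[_ _ ys]|//]; rewrite ys eqxx in sy.
have /split_last[J1 [t [J2 [eB pt nJ2]]]] : has (e (last p1 P)) (rcons J x').
  by rewrite has_rcons pJ orbT.
have [J3 eJ3] : exists J3, t :: J2 = rcons J3 x'.
  case: (rcons_split eB) => [[-> _ ->]|[J2' -> _]]; first by exists [::].
  by exists (t :: J2').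
have mA z : z \in rcons A1 s -> z \in rcons I y by rewrite eA -cat_rcons mem_cat => ->.
have mA' z : z \in rcons A1 s -> z \in x :: rcons I y by move/mA; rewrite inE => ->;
    rewrite orbT.
have mE z : z \in E -> z \in rcons I y by rewrite eA mem_cat inE => ->; rewrite !orbT.
have mE' z : z \in E -> z \in x :: rcons I y by move/mE; rewrite inE => ->; rewrite orbT.
have mI z : z \in rcons A1 s -> z \in I.
  by rewrite eI -cat_rcons mem_cat => ->.
have mB z : z \in t :: J2 -> z \in rcons J x' by rewrite eB mem_cat => ->; rewrite orbT.
have mB' z : z \in t :: J2 -> z \in y' :: rcons J x' by move/mB; rewrite inE => ->;
    rewrite orbT.
have hseg : ipath ((t :: J2) ++ x :: rcons A1 s).
  have h := @ihole_catC _ e e_sym _ _ (cfg_hole cfg); rewrite eA eB in h.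
  apply: (@ihole_infix _ e e_sym (y' :: J1) _ E) => //.
  by move: h; rewrite /= -!catA /= cat_rcons.
have hK : ihole (((t :: J2) ++ x :: rcons A1 s) ++ p1 :: P).
  apply: (ihole_arc e_sym) => //.
  - by rewrite size_cat /= size_rcons; clear; lia.
  - exact: cfg_P cfg.
  have lS u : last u ((t :: J2) ++ x :: rcons A1 s) = s.
    by rewrite last_cat /= last_rcons.
  move=> z v zP; rewrite mem_cat lS => /orP[vB|].
    rewrite cfg_PB ?mB' //; split=> //=.
    have -> : (v == s) = false.
      by rewrite eq_sym (cfg_AB _ (mB' _ vB)) // mA' // mem_rcons mem_head.
    rewrite andbF /=; case: (cfg_split_last zP) => [->|zb].
      rewrite eqxx /=; move: vB; rewrite inE => /predU1P[->|vJ]; first by rewrite pt eqxx.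
      rewrite (negbTE (hasPn nJ2 v vJ)); apply/esym/eqP => vt.
      by have := hasPn nJ2 v vJ; rewrite vt pt.
    rewrite cfg_bne //=; have := mB v vB; rewrite mem_rcons inE => /predU1P[->|vJ].
      by rewrite e_sym; apply/negbTE/(hasPn nx').
    exact: cfg_bJ.
  have tB : t \in y' :: rcons J x' by rewrite mB' ?mem_head.
  rewrite inE => /predU1P[->|vA].
    rewrite cfg_PA ?cfg_memx //= (cfg_AB cfg_memx tB) andbF orbF; split=> //.
    have -> : (x == s) = false.
      by apply: contraNF xI => /eqP->; apply: mI; rewrite mem_rcons mem_head.
    rewrite andbF e_sym; apply/negbTE; move: zP; rewrite inE => /predU1P[->//|].
    exact: (hasPn nx).
  rewrite cfg_PA ?mA' //= (cfg_AB (mA' _ vA) tB) andbF orbF; split=> //.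
  move: zP; rewrite inE => /predU1P[->|zP].
    rewrite eqxx /=; move: vA; rewrite mem_rcons inE => /predU1P[->|vA];
        first by rewrite ps eqxx.
    rewrite (negbTE (hasPn nA1 v vA)); apply/esym/eqP => vs.
    by have := hasPn nA1 v vA; rewrite vs ps.
  by rewrite cfg_P1 // cfg_PIe // mI.
have hL : ihole (x :: rcons (rcons A1 s ++ (p1 :: P) ++ J3) x').
  move: hK; rewrite eJ3 -catA => /(ihole_catC e_sym).
  by rewrite /= !rcons_cat /= rcons_cat -catA.
set L := rcons A1 s ++ (p1 :: P) ++ J3 in hL.
have mJ3 z : z \in J3 -> z \in J.
  move: eB; rewrite eJ3 -rcons_cat => /rcons_inj[->].
  by rewrite mem_cat => ->; rewrite orbT.
have inL z : z \in L -> [\/ z \in rcons A1 s, z \in p1 :: P | z \in J].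
  by rewrite !mem_cat => /or3P[->|->|/mJ3->]; [exact: Or31|exact: Or32|exact: Or33].
have nEL z : z \in E -> z \notin x :: rcons L x'.
  move=> zE; have zA := mE' z zE.
  have : uniq (x :: rcons I y) by exact: ipath_uniq (proj1 cfg_ipath).
  rewrite eA -cat_rcons -cat_cons => /uniq_catP uz.
  have nz : z \notin x :: rcons A1 s by apply: contraL zE; apply: uz.
  rewrite inE mem_rcons inE (cfg_AB zA cfg_memx') /=.
  move: nz; rewrite inE negb_or => /andP[/negbTE-> nz] /=.
  apply/negP => /inL[zA1|zP|zJ2].
  - by rewrite zA1 in nz.
  - by have := cfg_PA zP zA; rewrite eqxx.
  - by have := cfg_AB zA (cfg_memJ zJ2); rewrite eqxx.
have wK : w \notin x :: rcons L x'.
  rewrite inE mem_rcons inE (cfg_wA cfg_memx) (cfg_wB cfg_memx') /=.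
  apply/negP => /inL[/mA' wA|wP|wB].
  - by have := cfg_wA wA; rewrite eqxx.
  - by have := cfg_wnP; rewrite wP.
  - by have := cfg_wB (cfg_memJ wB); rewrite eqxx.
have wL : ~~ has (e w) L.
  apply/hasPn => z /inL[/mI zI|zP|zB]; first by rewrite cfg_wIe.
    by rewrite cfg_wPe.
  exact: (hasPn nwJ).
have hE : ipath (s :: E).
  have [+ _] := cfg_ipath; rewrite eA -cat_cons => /ipath_cat[] //.
have lE : last s E = y by rewrite eE last_rcons.
have yx' : e y x' = false by rewrite cfg_yB ?cfg_memx' // eq_sym (negbTE nxy').
have AE z u : z \in E -> u \in rcons A1 s -> e u z = (u == s) && (z == head z E).
  move=> zE uA; have [+ _] := cfg_ipath; rewrite eA -cat_rcons -cat_cons => /ipath_cat[_ _ l].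
  by have [|_ ->] := l u z _ zE; rewrite ?inE ?uA ?orbT //= last_rcons.
have nxE z : z \in E -> e x z = false by exact: cfg_xafter eA.
have nx'E z : z \in E -> e x' z = false.
  move=> zE; rewrite e_sym; have := mE z zE; rewrite mem_rcons inE => /predU1P[->//|zI].
  by rewrite cfg_IB ?cfg_memx'.
have nPE z v : z \in E -> v \in P -> e z v = false.
  move=> zE vP; have := mE z zE; rewrite e_sym mem_rcons inE => /predU1P[->|zI].
    by rewrite e_sym; apply/negbTE/(hasPn ny).
  exact: cfg_PIe.
(* Here [q] is the point where [E] leaves the new hole for good: the vertices of [F] between [q] and
   [w] see nothing in [L]. *)
have finish q F : {subset q :: F <= E} -> path e q F -> last q F = y -> has (e q) L ->
    {in F, forall z, ~~ e p1 z && ~~ has (e z) (rcons A1 s)} -> False.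
  move=> sF wF lF qL nF.
  apply: (@attach_edge _ e e_sym e_irr no_pyramid no_prism x x' L q (rcons F w) hL) => //.
  - by rewrite rcons_path wF lF e_sym (cfg_wy cfg).
  - move=> z; rewrite -rcons_cons mem_rcons inE => /predU1P[->//|/sF]; exact: nEL.
  - by rewrite nxE // sF ?mem_head.
  - by rewrite nx'E // sF ?mem_head.
  - by rewrite has_rcons e_sym (cfg_wx cfg).
  move=> z; rewrite mem_rcons inE => /predU1P[->|zF]; first by rewrite (cfg_wx cfg) wx'.
  have zE : z \in E by apply: sF; rewrite inE zF orbT.
  have /andP[pz zA] := nF z zF.
  rewrite !(e_sym z) nxE // nx'E //; split=> //; apply/hasPn => v /inL[vA|vP|vJ].
  - exact: (hasPn zA).
  - move: vP; rewrite inE => /predU1P[->|vP]; first by rewrite e_sym.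
    by rewrite nPE.
  - by rewrite (cfg_AJ _ vJ) // mE'.
have sL : s \in L by rewrite mem_cat mem_rcons mem_head.
have pL : p1 \in L by rewrite !mem_cat mem_head orbT.
have uE : uniq E by have := ipath_uniq hE => /andP[].
(* The vertex [q] is the last neighbour of [p1] in [E] or, failing one, the first vertex of [E],
   which sees [s]. *)
have [/split_last[E1 [q [F [eEF pq nF]]]]|npE] := boolP (has (e p1) E).
  apply: (finish q F).
  - by move=> z zF; rewrite eEF mem_cat zF orbT.
  - by apply: ipath_path; move: hE; rewrite eEF -cat_cons => /ipath_cat[].
  - by rewrite -lE eEF last_cat.
  - by apply/hasP; exists p1; rewrite // e_sym.
  move=> z zF; rewrite (hasPn nF) //=; apply/hasPn => u uA.
  have zE : z \in E by rewrite eEF mem_cat inE zF !orbT.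
  rewrite e_sym AE //; apply/nandP; right; move: uE; rewrite eEF.
  case: (E1) => [|a E1'] /=; first by case/andP => qF _; apply: contraNneq qF => <-.
  rewrite mem_cat inE negb_or negb_or => /andP[/and3P[_ _ aF] _].
  by apply: contraNneq aF => <-.
case: (E) lE npE hE uE AE finish {eA eE nEL mE mE' nxE nx'E nPE} =>
    [|q F] lE npE hE uE AE finish.
  by move: sy; rewrite -lE eqxx.
have /ipath_cons[_ sE hF] := hE.
apply: (finish q F) => //.
- exact: ipath_path.
- by apply/hasP; exists s => //; rewrite e_sym sE ?mem_head //= eqxx.
move=> z zF; rewrite (hasPn npE) ?inE ?zF ?orbT //=; apply/hasPn => u uA.
rewrite e_sym AE ?inE ?zF ?orbT //=; apply/nandP; right.
by have /andP[qF _] := uE; apply: contraNneq qF => <-.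
Qed.

End Facts.

(** * Impossibility of a configuration *)

Lemma config_untouched x I y y' J x' p1 P : config x I y y' J x' p1 P ->
  ~~ has (e x) P /\ ~~ has (e y) P.
Proof.
move=> cfg; have [xP|nx] := boolP (has (e x) P); have [yP|ny] := boolP (has (e y) P) => //.
- by case: (not_both_touched cfg xP yP).
- by case: (touched_one_side cfg xP ny).
- by case: (touched_one_side (config_rev cfg) yP nx).
Qed.

(** Used in both orientations, [end_attachment] makes each neighbour of [w] in [J] adjacent to [x']
    and to [y']. Hence [J] is a single vertex, and the length condition falls on [I]. *)
Lemma no_end_attachment x I y y' J x' p1 P : config x I y y' J x' p1 P ->
  2 <= size I \/ 2 <= size J ->
  ~~ has (e (last p1 P)) J -> e (last p1 P) x' -> ~~ e w x' -> False.
Proof.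
move=> cfg sIJ npJ px' nwx'.
have [nx ny] := config_untouched cfg.
have [P0 nwy' py' nxp zx'] := end_attachment cfg nx ny npJ px' nwx'.
have cfg' := config_rev cfg.
have npJ' : ~~ has (e (last p1 P)) (rev J) by rewrite has_rev.
have py'' : e (last p1 P) y' by rewrite P0.
have [_ _ _ nyp zy'] := end_attachment cfg' ny nx npJ' py'' nwy'.
have /hasP[z zJ wz] : has (e w) J.
  by have := center_meets_other_side_tail cfg; rewrite has_rcons (negbTE nwx').
have J0 : J != [::] by case: (J) zJ.
have sJ : size J = 1.
  have [[_ _ _ _ uJ] [yJ xJ nxy']] := cfg_ne cfg.
  have [_ hB] := cfg_ipath cfg.
  have zh : z == head z J.
    have /ipath_cons[_ h _] := hB; have := h z.
    rewrite mem_rcons inE zJ orbT zy' ?mem_rev // => /(_ isT)/esym.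
    by case: (J) J0.
  have zl : z == last z J.
    have := ipath_rev e_sym hB; rewrite -rcons_cons rev_rcons rev_cons.
    case/ipath_cons=> _ h _; have := h z;
        rewrite mem_rcons inE mem_rev zJ orbT zx' // => /(_ isT)/esym.
    by case/lastP: (J) J0 => // J' j _; rewrite rev_rcons last_rcons.
  case: (J) uJ zh zl J0 => // a [|b J'] //= /andP[aJ _] /eqP za.
  by rewrite za => /eqP al; rewrite al mem_last in aJ.
apply: (both_ends_attachment cfg) => //; last by case: sIJ; rewrite ?sJ.
by rewrite P0 in px'.
Qed.

(** The case of one vertex joining both sectors and seeing [x] and [y] is left as the premise
    [hub_case]: excluding it takes the assumption on major vertices, which concerns the whole of [H]
    and not the configuration. *)
Lemma no_config x I y y' J x' p1 P : config x I y y' J x' p1 P ->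
  2 <= size I \/ 2 <= size J ->
  (e w y' -> e w x' -> ~~ has (e w) J -> P = [::] -> e p1 x -> e p1 y ->
     has (e p1) J -> False) -> False.
Proof.
move=> cfg sIJ hub_case.
have [nx ny] := config_untouched cfg.
have cfg' := config_rev cfg.
have [pJ|npJ] := boolP (has (e (last p1 P)) J); last first.
  have := cfg_pk cfg; rewrite /far (negbTE npJ) /= => /orP[/andP[py' nwy']|/andP[px' nwx']].
    apply: (no_end_attachment cfg') => //; first by rewrite !size_rev.
    by rewrite has_rev.
  exact: (no_end_attachment cfg).
have [wJ|nwJ] := boolP (has (e w) J).
  exact: (sector_attachment cfg).
have wx' : e w x'.
  by have := center_meets_other_side_tail cfg; rewrite has_rcons (negbTE nwJ) orbF.
have wy' : e w y'.
  by have := center_meets_other_side_tail cfg'; rewrite has_rcons has_rev (negbTE nwJ) orbF.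
(* With the two sectors exchanged, the exclusion of touched ends says that [y'] and [x'] see no
   vertex of the path except possibly the last. *)
have [] := config_untouched (config_rot cfg wy' wx' nwJ pJ).
rewrite !has_rev => ny' nx'.
have [xp|nxp] := boolP (e x p1); last exact: (hub_one_end cfg).
have [yp|nyp] := boolP (e y p1); last first.
  by apply: (hub_one_end cfg'); rewrite ?has_rev.
have [P0|P0] := eqVneq P [::].
  by apply: hub_case; rewrite // 1?e_sym // ?P0 in pJ *.
have /split_first[J1 [b [J2 [eB pkb nJ1]]]] : has (e (last p1 P)) (y' :: rcons J x').
  by rewrite /= has_rcons pJ !orbT.
(* As [p1] sees [y], the detour may leave the sector at [c] = [y], with nothing of [I] on it. Then
   [x] meets it in [p1] and [w] in [y'], but these two are not adjacent. *)
have : e p1 y'.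
  apply: (@detour_last _ _ _ _ _ _ _ _ cfg y b I [::] J1 J2 _ _ _ eB pkb nJ1 ny) => //.
  - by rewrite cats1.
  - by rewrite e_sym.
  - by right.
  - by left.
  - by rewrite !inE eqxx orbT.
  - rewrite inE; apply/orP; right.
    by case: (J1) eB => [|j J1'] [-> _]; rewrite ?mem_head.
have p1b : p1 \in belast p1 P by case: (P) P0 => // a P' _; rewrite /= mem_head.
by rewrite e_sym; apply/negP/(hasPn ny').
Qed.

(** Induction on the length of [P] supplies the fields of [config]: a later vertex with a neighbour
    in [I] starts a shorter path, and an earlier vertex satisfying [far] ends one. *)
Lemma no_crossing x I y y' J x' :
  ihole ((x :: rcons I y) ++ (y' :: rcons J x')) -> I != [::] ->
  w \notin (x :: rcons I y) ++ (y' :: rcons J x') ->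
  e w x -> e w y -> ~~ has (e w) I -> 2 <= size I \/ 2 <= size J ->
  (forall p, p \notin (x :: rcons I y) ++ (y' :: rcons J x') ->
     e w y' -> e w x' -> ~~ has (e w) J -> e p x -> e p y ->
     has (e p) I -> has (e p) J -> False) ->
  forall p1 P, ipath (p1 :: P) -> ~~ has (e w) (p1 :: P) -> has (e p1) I ->
    far y' J x' (last p1 P) -> False.
Proof.
move=> hK I0 wK wx wy nwI sIJ hub_case p1 P.
have [n] := ubnP (size P); elim: n p1 P => // n IH p1 P sP hP nwP p1I pk.
have PI v : v \in P -> ~~ has (e v) I.
  move=> vP; apply/negP => vI; case/splitPr: vP hP nwP pk sP => A B.
  rewrite -cat_cons => /ipath_cat[_ hB _]; rewrite has_cat negb_or => /andP[_ nB].
  rewrite last_cat size_cat /= => pk sP; apply: (IH v B) => //.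
  by move: sP; clear; lia.
have Pf v : v \in belast p1 P -> ~~ far y' J x' v.
  move=> vP; apply/negP => vf; case/splitPr eP: {-1}_ / vP => [A B].
  have eP' : p1 :: P = rcons A v ++ rcons B (last p1 P).
    by rewrite lastI eP cat_rcons -rcons_cons -rcons_cat.
  have [F eF] : exists F, rcons A v = p1 :: F.
    by case: (A) eP' => [|a A'] /= [<- _]; [exists [::] | exists (rcons A' v)].
  have [eP2] : P = F ++ rcons B (last p1 P) by move: eP'; rewrite eF => -[].
  apply: (IH p1 F) => //.
  - by move: sP; rewrite eP2 size_cat size_rcons; clear; lia.
  - by move: hP; rewrite eP' eF => /ipath_cat[].
  - by move: nwP; rewrite eP' eF has_cat negb_or => /andP[].
  - by rewrite -[last p1 F]/(last p1 (p1 :: F)) -eF last_rcons.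
have linkP A u v B : p1 :: P = A ++ u :: v :: B -> e u v.
  move=> eP; move: hP; rewrite eP => /ipath_cat[_ /ipath_cons[_ h _] _].
  by rewrite h ?mem_head //= eqxx.
have cross u v : u \in x :: rcons I y -> v \in y' :: rcons J x' ->
    e u v -> u = y \/ u = x.
  move=> uA vB; have [_ _ _ l] := @ihole_cycP _ e (x :: _) (y' :: _) isT isT hK.
  have [_ ->] := l u v uA vB; rewrite /= !last_rcons.
  by case/orP=> /andP[/eqP-> _]; [left|right].
have [xI yI] : x \notin I /\ y \notin I.
  by split; [apply: contraL wx | apply: contraL wy] => /(hasPn nwI).
have crossI u v : u \in I -> v \in y' :: rcons J x' -> ~~ e u v.
  move=> uI vB; apply/negP => /cross[||uy|ux] //.
  - by rewrite inE mem_rcons inE uI !orbT.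
  - by rewrite -uy uI in yI.
  - by rewrite -ux uI in xI.
(* No vertex of the path is seen by [w], so [x] and [y] are avoided. A vertex in [I] would give its
   successor a neighbour in [I] or, being last, could not satisfy [far]; a vertex on the far arc
   would make its predecessor satisfy [far]. *)
have PK : {in p1 :: P, forall v, v \notin (x :: rcons I y) ++ (y' :: rcons J x')}.
  move=> v vP; apply/negP => vK; have nwv := hasPn nwP v vP.
  case/splitPr eP: {-1}_ / vP => [A B].
  move: vK; rewrite mem_cat inE mem_rcons inE -orbA -orbA => /or4P[/eqP vx|/eqP vy|vI|vB].
  - by rewrite vx wx in nwv.
  - by rewrite vy wy in nwv.
  - case: B eP => [|b B] eP.
      have lP : last p1 P = v by rewrite -[LHS]/(last p1 (p1 :: P)) eP last_cat.
      move: pk; rewrite lP /far; case/or3P=> [/hasP[z zJ]|/andP[vy' _]|/andP[vx' _]].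
      + by apply/negP/crossI; rewrite // inE mem_rcons inE zJ !orbT.
      + by case/negP: (crossI v y' vI (mem_head _ _)).
      + have x'B : x' \in y' :: rcons J x' by rewrite inE mem_rcons mem_head orbT.
        by case/negP: (crossI v x' vI x'B).
    have bP : b \in P.
      have : p1 :: P = rcons A v ++ b :: B by rewrite cat_rcons.
      by case: (A) => [|a A'] /= [_ ->]; rewrite ?mem_head // mem_cat mem_head orbT.
    have := PI b bP => /hasPn/(_ v vI); rewrite e_sym.
    by rewrite (linkP A v b B eP).
  - case/lastP: A eP => [|A u] eP.
      have /hasP[c cI] := p1I; have [-> _] := eP.
      by rewrite e_sym; apply/negP/crossI.
    rewrite cat_rcons in eP.
    have uP : u \in belast p1 P.
      have : rcons (belast p1 P) (last p1 P) = rcons (A ++ u :: belast v B) (last v B).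
        by rewrite -lastI eP rcons_cat rcons_cons -lastI.
      by move=> /rcons_inj[-> _]; rewrite mem_cat mem_head orbT.
    have uv := linkP A u v B eP.
    have /norP[nJ /norP[]] := Pf u uP.
    move: vB; rewrite inE mem_rcons inE => /or3P[/eqP vy'|/eqP vx'|vJ].
    + by rewrite -vy' uv nwv.
    + by rewrite -vx' uv nwv.
    + by have := hasPn nJ v vJ; rewrite uv.
apply: (@no_config x I y y' J x' p1 P) => //.
move=> wy' wx' nwJ P0 px py pJ.
by apply: (hub_case p1) => //; apply: PK; rewrite mem_head.
Qed.

End Center.
End Crossing.

(** * Significant paths *)

(** Successive cuts of a hole compose rotations, while [minor] and [sector] ask for a starting
    position below the length. *)
Lemma rot_rot_lt (S : Type) (s : seq S) m n :
  0 < size s -> exists2 k, k < size s & rot m (rot n s) = rot k s.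
Proof.
move=> s0; have lt k : exists2 j, j < size s & rot k s = rot j s.
  have [ks|ks] := ltnP k (size s); first by exists k.
  by exists 0; rewrite // rot0 rot_oversize.
have [n' ns ->] := lt n.
have [ms|ms] := leqP m (size s); last by exists n'; rewrite // rot_oversize // size_rot ltnW.
by rewrite rot_add_mod // 1?ltnW //; apply: lt.
Qed.

Section Wheels.
Variables (T : finType) (e : rel T).
Hypotheses (e_sym : symmetric e) (e_irr : irreflexive e).
Implicit Types (s A B I J : seq T) (u v w x y a b : T).

Lemma mem_NH s u v : u \notin s -> (v \in NH e s u) = (v \in s) && e u v.
Proof.
move=> us; rewrite inE; case vs: (v \in s) => //=.
by have -> : v != u by apply: contraNneq us => <-.
Qed.

Lemma minor_rot s u B : u \notin s -> NH e s u != set0 ->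
  (exists k, rot k s = B) ->
  (forall v, v \in s -> e u v -> v \in take 3 B) -> minor e s u.
Proof.
move=> us n0 [k kB] h; split=> //; split=> //.
have s0 : 0 < size s.
  by case: (s) n0 => // /set0Pn[v]; rewrite inE in_nil.
have [i si ei] := rot_rot_lt 0 k s0; rewrite rot0 kB in ei.
exists i; split=> //; apply/subsetP=> v; rewrite mem_NH // => /andP[vs uv].
by rewrite inE -ei h.
Qed.

Lemma major_card s u : u \notin s -> 3 < #|NH e s u| -> major e s u.
Proof.
move=> us c4; split=> //; split.
  by apply: contraTneq c4 => ->; rewrite cards0.
case=> _ [_ [i [_ /subset_leq_card]]]; apply/negP; rewrite -ltnNge.
apply: leq_trans c4; rewrite ltnS /vset cardsE.
by apply: leq_trans (card_size _) _; rewrite size_take_min geq_minl.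
Qed.

(** Here [w] is a hub, so every major vertex is one. The vertex [p] has four neighbours [x], [y],
    [a] in [I] and [b] in [J], hence is major; but each neighbour of a hub is adjacent to another
    one, and [b] is adjacent to none of [x], [y], [a]. *)
Lemma hub_no_crossing s w k x I y y' J x' p : hole e s ->
  rot k s = (x :: rcons I y) ++ y' :: rcons J x' -> major e s w ->
  ~ hub e s w \/ (forall u, major e s u -> hub e s u) ->
  I != [::] -> ~~ has (e w) I -> ~~ has (e w) J ->
  e w x -> e w y -> e w y' -> e w x' ->
  p \notin s -> e p x -> e p y -> has (e p) I -> has (e p) J -> False.
Proof.
move=> /(holeP e_sym e_irr) hs ek majw hubs I0 nI nJ wx wy wy' wx' ps px py pI pJ.
have [ws [nw0 _]] := majw.
have mK v : (v \in s) = (v \in (x :: rcons I y) ++ y' :: rcons J x') by rewrite -ek mem_rot.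
have hK : ihole e ((x :: rcons I y) ++ y' :: rcons J x').
  rewrite -ek /rot; apply: (ihole_catC e_sym); rewrite cat_take_drop //.
have [_ hA hB l] := @ihole_cycP _ e (x :: _) (y' :: _) isT isT hK.
have uK := ihole_uniq hK.
have J0 : J != [::] by case: (J) pJ.
have xA : x \in x :: rcons I y by rewrite mem_head.
have yA : y \in x :: rcons I y by rewrite inE mem_rcons mem_head orbT.
have y'B : y' \in y' :: rcons J x' by rewrite mem_head.
have x'B : x' \in y' :: rcons J x' by rewrite inE mem_rcons mem_head orbT.
have IA v : v \in I -> v \in x :: rcons I y.
  by move=> vI; rewrite inE mem_rcons inE vI !orbT.
have JB v : v \in J -> v \in y' :: rcons J x'.
  by move=> vI; rewrite inE mem_rcons inE vI !orbT.
have ipath_far a X c : X != [::] -> ipath e (a :: rcons X c) -> e a c = false.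
  move=> X0 /ipath_cons[_ h hX]; rewrite h ?mem_rcons ?mem_head //.
  move: (ipath_uniq hX); rewrite rcons_uniq; case: (X) X0 => // d X' _ /andP[+ _] /=.
  by rewrite inE negb_or => /andP[/negbTE->].
have hubw : hub e s w.
  split=> //; exists x', x, y, y'; split.
    apply/setP => v; rewrite mem_NH // mK !inE mem_cat !inE !mem_rcons !inE.
    have [->|_] := eqVneq v x; first by rewrite wx !orbT.
    have [->|_] := eqVneq v y; first by rewrite wy !orbT.
    have [->|_] := eqVneq v y'; first by rewrite wy' !orbT.
    have [->|_] := eqVneq v x'; first by rewrite wx' !orbT.
    apply/negbTE; rewrite /= ; apply/nandP.
    case: (boolP (v \in I)) => [/(hasPn nI) h|_]; first by right.
    by case: (boolP (v \in J)) => [/(hasPn nJ) h|_]; [right|left].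
  split; first split.
  - by split; rewrite mK mem_cat ?xA ?yA ?x'B ?y'B ?orbT.
  - have s0 : 0 < size s by case: (s) hs.
    have [i _ ei] := rot_rot_lt (size ((x :: rcons I y) ++ y' :: J)) k s0.
    have eK : (x :: rcons I y) ++ y' :: rcons J x' = ((x :: rcons I y) ++ y' :: J) ++ [:: x'].
      by rewrite cats1 rcons_cat rcons_cons.
    rewrite ek eK rot_size_cat in ei.
    exists i; rewrite -ei.
    (* Starting the rotation at [x'] puts [x'], [x], [y], [y'] at positions 0, 1, |I|+2 and |I|+3,
       in the order a hub requires. *)
    pose r := [:: x', x & I ++ [:: y, y' & J]].
    have er : [:: x'] ++ (x :: rcons I y) ++ y' :: J = r by rewrite /= cat_rcons.
    rewrite er; have : uniq ([:: x'] ++ (x :: rcons I y) ++ y' :: J).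
      by rewrite uniq_catC -eK.
    rewrite er => ur.
    have ix j : j < size r -> index (nth x r j) r = j by move=> jr; apply: index_uniq.
    have sr : size r = (size I + (size J).+2).+2 by rewrite /r /= size_cat.
    have ey : nth x r (size I).+2 = y by rewrite /r /= nth_cat ltnn subnn.
    have ey' : nth x r (size I).+3 = y'.
      by rewrite /r /= nth_cat ltnNge leqnSn /= subSnn.
    have [i0 [i1 [i2 i3]]] := (ix 0 isT, (ix 1 isT, (ix (size I).+2, ix (size I).+3))).
    rewrite [nth x r 0]/= in i0; rewrite [nth x r 1]/= in i1.
    rewrite ey sr in i2; rewrite ey' sr in i3.
    have l2 : (size I).+2 < (size I + (size J).+2).+2 by clear; lia.
    have l3 : (size I).+3 < (size I + (size J).+2).+2 by clear; lia.
    by cbv zeta; rewrite i0 i1 i2 // i3.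
  - split.
    + by rewrite e_sym; have [_ ->] := l x x' xA x'B; rewrite /= !last_rcons !eqxx orbT.
    + by have [_ ->] := l y y' yA y'B; rewrite /= !last_rcons !eqxx.
    + by rewrite e_sym (ipath_far y' J x').
    + by rewrite (ipath_far x I y).
case: hubs => [//|hubs].
have /hasP[a aI pa] := pI; have /hasP[b bJ pb] := pJ.
have by'x' : (b != y') /\ (b != x').
  move: (ipath_uniq hB); rewrite /= mem_rcons inE negb_or rcons_uniq.
  case/andP=> /andP[_ yJ] /andP[xJ _].
  by split; [apply: contraNneq yJ => <- | apply: contraNneq xJ => <-].
have Ab v : v \in x :: rcons I y -> v != b /\ e v b = false.
  move=> vA; have [-> ->] := l v b vA (JB b bJ); split=> //.
  by rewrite /= !last_rcons; case: by'x' => /negbTE-> /negbTE->; rewrite !andbF.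
have e_b v : v \in [set x; y; a; b] -> e b v = false.
  rewrite !inE -!orbA e_sym => /or4P[] /eqP->; last by rewrite e_irr.
  - by have [] := Ab x xA.
  - by have [] := Ab y yA.
  - by have [] := Ab a (IA a aI).
have c4 : #|[set x; y; a; b]| = 4.
  have u4 : uniq [:: x; y; a; b].
    have [[xb _] [yb _] [ab _]] := And3 (Ab x xA) (Ab y yA) (Ab a (IA a aI)).
    move: (ipath_uniq hA); rewrite /= mem_rcons inE negb_or rcons_uniq.
    case/andP=> /andP[xy xI] /andP[yI _].
    rewrite !inE !negb_or xy xb yb ab /= !andbT.
    by apply/andP; split; [apply: contraNneq xI => -> | apply: contraNneq yI => ->].
  by rewrite -[4](card_uniqP u4); apply: eq_card => v; rewrite !inE -!orbA.
have sub : [set x; y; a; b] \subset NH e s p.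
  apply/subsetP => v hv; rewrite mem_NH //; apply/andP.
  move: hv; rewrite !inE -!orbA => /or4P[] /eqP->; rewrite mK mem_cat; split=> //.
  - by rewrite xA.
  - by rewrite yA.
  - by rewrite IA.
  - by rewrite JB // orbT.
have majp : major e s p.
  by apply: major_card => //; rewrite -c4 subset_leq_card.
have [_ [x1 [y1 [z1 [w1 [eN [_ [e1 e2 _ _]]]]]]]] := hubs p majp.
(* A hub has at most four neighbours, so the four found for [p] are all of them. *)
have eqN : [set x; y; a; b] = NH e s p.
  apply/eqP; rewrite eqEcard sub c4 eN.
  apply: leq_trans (leq_card_setU _ _) _; rewrite cards1 addn1 ltnS.
  apply: leq_trans (leq_card_setU _ _) _; rewrite cards1 addn1 ltnS.
  by apply: leq_trans (leq_card_setU _ _) _; rewrite !cards1.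
have bN : b \in [set x1; y1; z1; w1].
  by rewrite -eN -eqN !inE eqxx !orbT.
rewrite eqN eN in e_b.
move: bN; rewrite !inE -!orbA => /or4P[] /eqP eb.
- by have := e_b y1; rewrite eb e1 !inE eqxx !orbT => /(_ isT).
- by have := e_b x1; rewrite eb e_sym e1 !inE eqxx => /(_ isT).
- by have := e_b w1; rewrite eb e2 !inE eqxx !orbT => /(_ isT).
- by have := e_b z1; rewrite eb e_sym e2 !inE eqxx !orbT => /(_ isT).
Qed.

(** As [a] is a nonneighbour of [w], it lies inside the sector between the nearest neighbours of [w]
    on either side, and [distant] is applied to that sector. Being major leaves at least two
    vertices outside the sector, so that [y'] and [x'] exist and differ. *)
Lemma significant_frame s w p1 pk a b : uniq s -> major e s w -> a \in NH e s p1 :\: NH e s w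
    -> b \in NH e s pk ->
  distant e s w a b ->
  exists k x I y y' J x', [/\ rot k s = (x :: rcons I y) ++ y' :: rcons J x',
    e w x, e w y & ~~ has (e w) I] /\ [/\ a \in I, e p1 a & far e w y' J x' pk].
Proof.
move=> us [ws [nw0 nminor]]; rewrite !inE; case/andP=> nwa /and3P[as_ _ pa].
case/and3P=> bs _ pb dab.
have s0 : 0 < size s by case: (s) as_.
have awn : a != w by apply: contraNneq ws => <-.
rewrite as_ awn /= in nwa.
have [k0 L eL] := rot_to as_.
have mL v : (v \in s) = (v \in a :: L) by rewrite -eL mem_rot.
have NHin v : v \in s -> e w v -> v \in L.
  by rewrite mL inE => /predU1P[->|//]; rewrite (negbTE nwa).
have wL : has (e w) L.
  case/set0Pn: nw0 => v; rewrite mem_NH // => /andP[vs wv].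
  by apply/hasP; exists v => //; apply: NHin.
have [L1 [y [L2 [e1 wy nw1]]]] := split_first wL.
have [/split_last[L3 [x [L4 [e2 wx nw4]]]]|nw2] := boolP (has (e w) L2); last first.
  case: nminor; apply: (@minor_rot s w (y :: L2 ++ a :: L1)) => //.
    have [k1 _ ek1] := rot_rot_lt (size (a :: L1)) k0 s0; exists k1.
    by rewrite -ek1 eL e1 -cat_cons rot_size_cat.
  move=> v vs wv; have := NHin v vs wv; rewrite e1 mem_cat inE => /or3P[vL|/eqP->|vL].
  - by have := hasPn nw1 v vL; rewrite wv.
  - by rewrite /= mem_head.
  - by have := hasPn nw2 v vL; rewrite wv.
have eL' : rot k0 s = (a :: L1) ++ y :: L3 ++ x :: L4 by rewrite eL e1 e2.
have [k1 _ ek1] := rot_rot_lt (size (a :: L1)) k0 s0.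
rewrite eL' rot_size_cat in ek1.
have Nin v : v \in s -> e w v -> v \in y :: L3 ++ [:: x].
  move=> vs wv; have := NHin v vs wv; rewrite e1 e2 !(mem_cat, inE).
  case/orP=> [vL|]; first by have := hasPn nw1 v vL; rewrite wv.
  case/or4P=> [->//|->|->|vL]; rewrite ?orbT //.
  by have := hasPn nw4 v vL; rewrite wv.
(* With at most one vertex between [y] and [x] outside the sector, all neighbours of [w] lie on
   three consecutive vertices and [w] would be minor. *)
have [J3|] := leqP (size L3) 1.
  case: nminor; apply: (@minor_rot s w (y :: (L3 ++ x :: L4) ++ a :: L1)) => //.
    by exists k1.
  move=> v vs wv; have := Nin v vs wv.
  case: (L3) J3 => [|c [|//]] _ //=; last by rewrite take0.
  by case: (L4) => [|? ?] /=; rewrite !inE => /orP[] ->; rewrite ?orbT.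
case eL3: L3 => [//|y' L3']; case/lastP: L3' eL3 => [//|J x'] eL3 _.
(* The hole was cut open at [a], so the interior of the sector wraps around the cut. *)
pose I := L4 ++ a :: L1.
have [k si ek] := rot_rot_lt (size (y :: L3)) k1 s0.
have {}ek : rot k s = (x :: rcons I y) ++ y' :: rcons J x'.
  rewrite -ek -ek1 (_ : (y :: L3 ++ x :: L4) ++ a :: L1 = (y :: L3) ++ x :: I).
    by rewrite rot_size_cat eL3 /= cat_rcons.
  by rewrite /I /= -!catA.
exists k, x, I, y, y', J, x'; split; split=> //.
- rewrite /I has_cat /= (negbTE nwa) (negbTE nw4) (negbTE nw1) //.
- by rewrite /I mem_cat mem_head orbT.
have mK v : (v \in s) = (v \in (x :: rcons I y) ++ y' :: rcons J x') by rewrite -ek mem_rot.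
have sK : size s = size ((x :: rcons I y) ++ y' :: rcons J x') by rewrite -ek size_rot.
pose m := size (x :: rcons I y).
have tK : take m (rot k s) = x :: rcons I y by rewrite ek take_size_cat.
have dK : drop m (rot k s) = y' :: rcons J x' by rewrite ek drop_size_cat.
have nI : ~~ has (e w) I by rewrite /I has_cat /= (negbTE nwa) (negbTE nw4).
have sec : sector e s w k m.
  split=> //; split.
    rewrite sK size_cat /m /= !size_rcons; clear; lia.
  rewrite tK /m /= => x0; split=> //.
    by rewrite size_rcons /= nth_rcons ltnn eqxx.
  move=> j; rewrite size_rcons; case: j => // j /andP[_]; rewrite ltnS => ji.
  by rewrite /= nth_rcons ji; apply: (hasPn nI); apply: mem_nth.
have lK : drop (size (rot k s)).-1 (rot k s) = [:: x'].
  have -> : rot k s = rcons ((x :: rcons I y) ++ y' :: J) x'.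
    by rewrite ek rcons_cat rcons_cons.
  by rewrite size_rcons drop_rcons ?drop_size.
have aext : a \in ext_nbhd e s w k m.
  by rewrite /ext_nbhd tK !inE mem_rcons inE /I mem_cat mem_head !orbT.
(* The extended neighbourhood is the sector with those of [y'] and [x'] that [w] sees. Outside it
   remain [J] and the nonneighbours of [w] among [y'] and [x'], which is what [far] lists. *)
have : b \notin ext_nbhd e s w k m by apply/negP => bext; apply: (dab k m sec).
rewrite /ext_nbhd tK dK lK [_ \in _]inE negb_or => /andP[nb1 nb2].
have bB : b \in y' :: rcons J x'.
  by move: bs; rewrite mK mem_cat; move: nb1; rewrite inE => /negbTE->.
move: nb2; rewrite inE /= take0 /= !inE /far.
move: bB; rewrite inE mem_rcons inE => /or3P[/eqP<-|/eqP<-|bJ].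
- by rewrite eqxx /= pb => ->; rewrite orbT.
- by rewrite eqxx orbT /= pb => ->; rewrite !orbT.
- by move=> _; apply/orP; left; apply/hasP; exists b.
Qed.

End Wheels.

Theorem theorem2p13 (T : finType) (e : rel T) (e_sym : symmetric e)
  (e_irr : irreflexive e) (GC : in_C e) (s : seq T) (Hs : hole e s)
  (Hlen : 6 < size s) (w : T) (Hw : major e s w)
  (Hhub : ~ hub e s w \/ (forall u, major e s u -> hub e s u))
  (P : seq T) (HP : significant e s w P) :
  exists2 v, v \in P & e w v.
Proof.
have [no_theta [no_pyramid [no_prism no_turtle]]] := GC.
apply/hasP/negPn/negP => nwP.
have hs : ihole e s by apply/holeP.
have [hP [p1 [oP [a [b [ha hb dab]]]]]] := HP.
case: P nwP hP oP hb {HP} => // q P nwP hP [eq] /= hb.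
rewrite {q}eq in nwP hP hb *.
have {}hP : ipath e (p1 :: P) by have [] := (induced_pathP e_sym e_irr _).1 hP.
have [k [x [I [y [y' [J [x' [[ek wx wy nwI] [aI p1a pk]]]]]]]]] :=
  significant_frame (ihole_uniq hs) Hw ha hb dab.
have mK v : (v \in (x :: rcons I y) ++ y' :: rcons J x') = (v \in s) by rewrite -ek mem_rot.
have I0 : I != [::] by case: (I) aI.
have p1I : has (e p1) I by apply/hasP; exists a.
apply: (@no_crossing _ e e_sym e_irr no_theta no_pyramid no_prism no_turtle w x I y y' J x'
  _ I0 _ wx wy nwI _ _ p1 P hP nwP p1I pk).
- by rewrite -ek /rot; apply: (ihole_catC e_sym); rewrite cat_take_drop.
- by rewrite mK; case: Hw.
(* The length is |I| + |J| + 4, so length at least seven keeps [I] and [J] from both having at most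
   one vertex. *)
- move: Hlen; rewrite -(size_rot k) ek size_cat /= !size_rcons; clear.
  by case: (size I) => [|[|n]]; [right|right|left]; lia.
- move=> p; rewrite mK => ps wy' wx' nwJ px py pI pJ.
  exact: (hub_no_crossing e_sym e_irr Hs ek Hw Hhub I0 nwI nwJ wx wy wy' wx' ps px py pI pJ).
Qed.
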